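(* Let $M$ be a smooth manifold and let $(f,F)$ be an orthogonal automorphism of the direct sum $T\oplus T^*$. Suppose also that $F$ preserves the Courant bracket, i.e. $F([A,B])=[F(A),F(B)]$ for all sections $A,B\in C^\infty(T\oplus T^* )$. Then $F$ must be the composition of a diffeomorphism of $M$ and a $B$-field transformation. To be more precise, the group of orthogonal Courant automorphisms of $T\oplus T^*$ is the semidirect product of $\mathrm{Diff}(M)$ and $\Omega^2_{\mathrm{closed}}(M)$.
   Context: $T\oplus T^*$ carries the inner product $\langle X+\xi,Y+\eta\rangle=\frac12(\xi(Y)+\eta(X))$ and the Courant bracket $[X+\xi,Y+\eta]=[X,Y]+\mathcal{L}_X\eta-\mathcal{L}_Y\xi-\frac12 d(i_X\eta-i_Y\xi)$ on smooth sections. An automorphism of a vector bundle $E\to M$ is a pair $(f,F)$ of diffeomorphisms $f:M\to M$, $F:E\to E$ with $F$ covering $f$ and linear on each fibre; it is orthogonal if it preserves the inner product on fibres. $F$ acts on sections by $A\mapsto F\circ A\circ f^{-1}$. A diffeomorphism $f$ acts on $T\oplus T^*$ by $f_*\oplus(f^* )^{-1}$. A $B$-field transformation is the map $e^B:X+\xi\mapsto X+\xi+i_XB$ (covering the identity) for a closed real 2-form $B$. $\Omega^2_{\mathrm{closed}}(M)$ is the additive group of closed 2-forms. *)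

(* Defs.v *)
From mathcomp Require Import all_boot all_order all_algebra.
From mathcomp Require Import all_classical all_reals all_analysis.

Set Implicit Arguments.
Unset Strict Implicit.
Unset Printing Implicit Defensive.

Import Order.TTheory GRing.Theory Num.Theory.
Import numFieldNormedType.Exports.

Local Open Scope classical_set_scope.
Local Open Scope ring_scope.

(* C^k on an open set [U]: Frechet differentiable with every x |-> 'd f x v of
   class C^(k-1). For finite-dimensional [V] this is the existence and
   continuity of all partial derivatives up to order k. *)
Fixpoint cdiff (R : realType) (V W : normedModType R) (k : nat)
    (U : set V) (f : V -> W) : Prop :=
  if k is k'.+1 then
    (forall x, U x -> differentiable f x) /\
    (forall v, cdiff k' U (fun x => 'd f x v))
  else forall x, U x -> {for x, continuous f}.

Definition smooth_on (R : realType) (V W : normedModType R)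
    (U : set V) (f : V -> W) : Prop := forall k, cdiff k U f.

(* A chart is [to] restricted to [source]; its inverse is [from] restricted to
   [target]. The values outside these sets are irrelevant. *)
Record chart (R : realType) (T : Type) (V : normedModType R) := Chart {
  source : set T;
  to : T -> V;
  from : V -> T }.

Definition target (R : realType) (T : Type) (V : normedModType R)
  (c : chart T V) : set V := to c @` source c.

Definition transition (R : realType) (T : Type) (V : normedModType R)
  (c c' : chart T V) : V -> V := to c' \o from c.

(* The openness clause is the continuity of [f]. *)
Definition smooth_map (R : realType) (T T' : Type) (V V' : normedModType R)
    (A : set (chart T V)) (A' : set (chart T' V')) (f : T -> T') : Prop :=
  forall c c', A c -> A' c' ->
    let W := to c @` (source c `&` f @^-1` source c') in
    open W /\ smooth_on W (to c' \o f \o from c).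

Definition diffeomorphism (R : realType) (T T' : Type) (V V' : normedModType R)
    (A : set (chart T V)) (A' : set (chart T' V')) (f : T -> T') : Prop :=
  smooth_map A A' f /\
  exists g, [/\ smooth_map A' A g, cancel f g & cancel g f].

Record manifold (R : realType) (n : nat) := Manifold {
  space :> topologicalType;
  manifold_hausdorff : hausdorff_space space;
  manifold_countable : @second_countable space;
  atlas : set (chart space 'rV[R]_n);
  atlas_cover : forall p, exists2 c, atlas c & source c p;
  atlas_chart : forall c, atlas c ->
    [/\ open (source c), open (target c),
        forall p, source c p -> from c (to c p) = p,
        forall p, source c p -> {for p, continuous (to c)}
      & forall x, target c x -> {for x, continuous (from c)}];
  atlas_compatible : forall c c', atlas c -> atlas c' ->
    smooth_on (to c @` (source c `&` source c')) (transition c c') }.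

Arguments atlas {R n} M : rename.

Definition chart_at (R : realType) (n : nat) (M : manifold R n) (p : M) :
  chart M 'rV[R]_n := s2val (cid2 (atlas_cover p)).

(* The fibre of T + T^* at [p] is written in the coordinates of [chart_at p]:
   tangent vectors are rows, covectors are columns. The bundle structure is
   then carried by the change of coordinates to the other charts. *)
Notation fibre R n := ('rV[R]_n * 'cV[R]_n)%type.

(* With [jacobian f x] of entries d_i f_j, a vector [v] is pushed forward to
   [v *m jacobian f x] and a covector [xi] pulled back to
   [jacobian f x *m xi]. *)
Definition vec_change (R : realType) (n : nat) (T : Type)
    (c c' : chart T 'rV[R]_n) (x v : 'rV[R]_n) : 'rV[R]_n :=
  v *m jacobian (transition c c') x.

(* Covectors transform by the Jacobian of the reverse transition map. *)
Definition cov_change (R : realType) (n : nat) (T : Type)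
    (c c' : chart T 'rV[R]_n) (x : 'rV[R]_n) (xi : 'cV[R]_n) : 'cV[R]_n :=
  jacobian (transition c' c) (transition c c' x) *m xi.

Section Bundle.
Variables (R : realType) (n : nat) (M : manifold R n).
Implicit Types (c : chart M 'rV[R]_n) (p : M).

Definition total_space : Type := (M * fibre R n)%type.

Definition pos p : 'rV[R]_n := to (chart_at p) p.

Definition bundle_chart c : chart total_space ('rV[R]_n * fibre R n)%type := {|
  source := [set e | source c e.1];
  to := fun e =>
    let p := e.1 in
    (to c p, (vec_change (chart_at p) c (pos p) e.2.1,
              cov_change (chart_at p) c (pos p) e.2.2));
  from := fun y =>
    let p := from c y.1 in
    (p, (vec_change c (chart_at p) y.1 y.2.1,
         cov_change c (chart_at p) y.1 y.2.2)) |}.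

Definition bundle_atlas : set (chart total_space ('rV[R]_n * fibre R n)%type) :=
  bundle_chart @` atlas M.

Definition smooth_section (A : M -> fibre R n) : Prop :=
  smooth_map (atlas M) bundle_atlas (fun p => (p, A p) : total_space).

Definition vec_in c (X : M -> 'rV[R]_n) (x : 'rV[R]_n) : 'rV[R]_n :=
  let p := from c x in vec_change (chart_at p) c (pos p) (X p).

Definition cov_in c (xi : M -> 'cV[R]_n) (x : 'rV[R]_n) : 'cV[R]_n :=
  let p := from c x in cov_change (chart_at p) c (pos p) (xi p).

Definition pairing (v : 'rV[R]_n) (xi : 'cV[R]_n) : R := (v *m xi) 0 0.

Definition inner (a b : fibre R n) : R :=
  2^-1 * (pairing b.1 a.2 + pairing a.1 b.2).

(* [X,Y]^j = X^i d_i Y^j - Y^i d_i X^j *)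
Definition lie_bracket (X Y : M -> 'rV[R]_n) (p : M) : 'rV[R]_n :=
  let c := chart_at p in
  'D_(X p) (vec_in c Y) (pos p) - 'D_(Y p) (vec_in c X) (pos p).

(* (L_X eta)_i = X^j d_j eta_i + (d_i X^j) eta_j *)
Definition lie_derivative (X : M -> 'rV[R]_n) (eta : M -> 'cV[R]_n) (p : M) :
    'cV[R]_n :=
  let c := chart_at p in
  'D_(X p) (cov_in c eta) (pos p) + jacobian (vec_in c X) (pos p) *m eta p.

Definition differential (h : M -> R) (p : M) : 'cV[R]_n :=
  \col_i 'D_(delta_mx 0 i) (h \o from (chart_at p)) (pos p).

Definition courant (A B : M -> fibre R n) (p : M) : fibre R n :=
  let X q := (A q).1 in let xi q := (A q).2 in
  let Y q := (B q).1 in let eta q := (B q).2 in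
  (lie_bracket X Y p,
   lie_derivative X eta p - lie_derivative Y xi p
   - 2^-1 *: differential
       (fun q => pairing (X q) (eta q) - pairing (Y q) (xi q)) p).

Definition bundle_automorphism (f : M -> M)
    (F : total_space -> total_space) : Prop :=
  [/\ diffeomorphism (atlas M) (atlas M) f,
      diffeomorphism bundle_atlas bundle_atlas F,
      forall e, (F e).1 = f e.1
    & forall p, linear (fun a : fibre R n => (F (p, a)).2)].

Definition orthogonal_automorphism (F : total_space -> total_space) : Prop :=
  forall p (a b : fibre R n), inner (F (p, a)).2 (F (p, b)).2 = inner a b.

(* F o A o f^-1, where [g] stands for the inverse of [f] *)
Definition act (g : M -> M) (F : total_space -> total_space)
    (A : M -> fibre R n) (p : M) : fibre R n :=
  (F (g p, A (g p))).2.

Definition preserves_courant (f : M -> M)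
    (F : total_space -> total_space) : Prop :=
  forall g, cancel f g -> cancel g f ->
  forall A B, smooth_section A -> smooth_section B ->
    act g F (courant A B) = courant (act g F A) (act g F B).

Definition tangent (f : M -> M) (p : M) : 'M[R]_n :=
  jacobian (to (chart_at (f p)) \o f \o from (chart_at p)) (pos p).

(* f_* + (f^* )^-1 *)
Definition diff_action (f : M -> M) (e : total_space) : total_space :=
  (f e.1, (e.2.1 *m tangent f e.1, invmx (tangent f e.1) *m e.2.2)).

(* A 2-form is a field of matrices: B(v, w) = v *m B p *m w^T. *)
Definition form_in c (B : M -> 'M[R]_n) (x : 'rV[R]_n) : 'M[R]_n :=
  let p := from c x in
  let J := jacobian (transition c (chart_at p)) x in
  J *m B p *m J^T.

Definition two_form (B : M -> 'M[R]_n) : Prop :=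
  (forall p, (B p)^T = - B p) /\
  (forall c, atlas M c -> smooth_on (target c) (form_in c B)).

(* (dB)_ijk = d_i B_jk + d_j B_ki + d_k B_ij *)
Definition exterior_derivative (B : M -> 'M[R]_n) (p : M) (u v w : 'rV[R]_n) :
    R :=
  let D (a b b' : 'rV[R]_n) :=
    (b *m 'D_a (form_in (chart_at p) B) (pos p) *m b'^T) 0 0 in
  D u v w + D v w u + D w u v.

Definition closed_two_form (B : M -> 'M[R]_n) : Prop :=
  two_form B /\ forall p u v w, exterior_derivative B p u v w = 0.

Definition contract (v : 'rV[R]_n) (b : 'M[R]_n) : 'cV[R]_n := (v *m b)^T.

Definition B_field (B : M -> 'M[R]_n) (e : total_space) : total_space :=
  (e.1, (e.2.1, e.2.2 + contract e.2.1 (B e.1))).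

End Bundle.

Record operation (T : Type) := Operation {
  elements : set T;
  mul : T -> T -> T;
  one : T }.

Definition is_group (T : Type) (G : operation T) : Prop :=
  [/\ elements G (one G),
      forall x y, elements G x -> elements G y -> elements G (mul G x y),
      forall x y z, elements G x -> elements G y -> elements G z ->
        mul G x (mul G y z) = mul G (mul G x y) z,
      forall x, elements G x -> mul G (one G) x = x /\ mul G x (one G) = x
    & forall x, elements G x ->
        exists2 y, elements G y & mul G x y = one G /\ mul G y x = one G].

Definition injective_morphism (T T' : Type) (G : operation T)
    (G' : operation T') (h : T -> T') : Prop :=
  [/\ forall x, elements G x -> elements G' (h x),
      forall x y, elements G x -> elements G y ->
        h (mul G x y) = mul G' (h x) (h y)
    & forall x y, elements G x -> elements G y -> h x = h y -> x = y].

(* [G] is the internal semidirect product of the subgroup [s Q] and the normal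
   subgroup [i K]. *)
Definition semidirect_product (TG TQ TK : Type) (G : operation TG)
    (Q : operation TQ) (K : operation TK) (s : TQ -> TG) (i : TK -> TG) :
    Prop :=
  [/\ is_group G, is_group Q & is_group K] /\
  [/\ injective_morphism Q G s,
      injective_morphism K G i,
      forall g k, elements G g -> elements K k ->
        exists2 k', elements K k' & mul G g (i k) = mul G (i k') g,
      forall q k, elements Q q -> elements K k -> s q = i k -> s q = one G
    & forall g, elements G g -> exists q k,
        [/\ elements Q q, elements K k & g = mul G (s q) (i k)]].

Arguments bundle_atlas {R n} M.
Arguments closed_two_form {R n} M B.
Arguments diff_action {R n} M f e.
Arguments B_field {R n} M B e.

Section Groups.
Variables (R : realType) (n : nat) (M : manifold R n).

Definition courant_automorphisms :
    operation ((M -> M) * (total_space M -> total_space M))%type := {|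
  elements := [set a | [/\ bundle_automorphism a.1 a.2,
                           orthogonal_automorphism a.2
                         & preserves_courant a.1 a.2]];
  mul := fun a b => (a.1 \o b.1, a.2 \o b.2);
  one := (id, id) |}.

Definition Diff : operation (M -> M) := {|
  elements := diffeomorphism (atlas M) (atlas M);
  mul := fun f g => f \o g;
  one := id |}.

Definition closed_two_forms : operation (M -> 'M[R]_n) := {|
  elements := closed_two_form M;
  mul := fun B C p => B p + C p;
  one := fun=> 0 |}.

Definition diff_automorphism (f : M -> M) :
  (M -> M) * (total_space M -> total_space M) := (f, diff_action M f).

Definition B_field_automorphism (B : M -> 'M[R]_n) :
  (M -> M) * (total_space M -> total_space M) := (id, B_field M B).

End Groups.

Arguments diff_automorphism {R n} M f.
Arguments B_field_automorphism {R n} M B.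

(* Main.v *)
Require Import Defs.
From HB Require Import structures.
From mathcomp Require Import all_boot all_order all_algebra.
From mathcomp Require Import all_classical all_reals all_analysis.
From mathcomp Require Import ring lra.

(* If G covers the identity, preserves the inner product and commutes with the
   Courant bracket, compare G [A, B'] and [G A, G B'] at a point p where B'
   vanishes with derivative v |-> (v . lam) b. There
     [A, B'] = (pi(A) . lam) b - <A, b> lam,
   so (pi(A) . lam - pi(G A) . lam) G b = <A, b> (G lam - lam) for all A, b and
   lam. Taking b <> 0 orthogonal to A gives pi G = pi, and then G is the identity
   on T^*. By orthogonality G = e^B for a skew form B, and on sections with given
   values at p the bracket changes under e^B by the contraction of dB, whence
   dB = 0. A general pair (f, F) is reduced to this case by composing with the
   action of the inverse of f, which preserves the bracket because second
   derivatives are symmetric. Normality of the B-fields follows: the conjugate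
   of e^B by F is an orthogonal Courant automorphism over the identity. *)

Set Implicit Arguments.
Unset Strict Implicit.
Unset Printing Implicit Defensive.

Import Order.TTheory GRing.Theory Num.Theory.
Import numFieldNormedType.Exports.

Local Open Scope classical_set_scope.
Local Open Scope ring_scope.

(* [constructive_ereal] also has a [contract]. *)
Local Notation contract := Defs.contract.

(** * Finite-dimensional normed spaces and C^k functions *)

(** The bracket at a point depends only on values and first derivatives there, but
    [preserves_courant] speaks of global smooth sections. Every 1-jet used in the comparison must
    therefore first be extended to all of [M], which is what brings bump functions into the proof.
    Letting the second section vanish at [p] has a purpose: the derivative of [G] at [p] then never
    enters, and [G] acts on the derivative of that section through its value at [p] alone.

    The main obstacle is one of coordinates. A section stores its value at [q] in the coordinates of
    [chart_at q], a chart that may jump with [q], so nothing can be differentiated in this form.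
    Each computation passes to the expression [loc c A] in a fixed chart [c], where the bracket
    becomes an operator on functions on ['rV[R]_n]. In the same spirit the inverse of a tangent map
    is read as the tangent map of the inverse diffeomorphism, so that its smoothness comes from that
    of the diffeomorphism and not from a study of matrix inversion. *)

Class fin_dim (R : realType) (V : normedModType R) : Prop :=
  fin_dimP : exists m (e : 'I_m -> V) (l : 'I_m -> V -> R),
    [/\ forall i, linear (l i : V -> R^o), forall i, continuous (l i)
      & forall v, v = \sum_i l i v *: e i].

#[export] Instance fin_dim_scalar (R : realType) : fin_dim (R : normedModType R).
Proof.
exists 1%N, (fun=> 1), (fun _ => id); split=> // [i x|v]; first exact: cvg_id.
by rewrite big_ord1 /GRing.scale /= mulr1.
Qed.

#[export] Instance fin_dim_matrix (R : realType) m n :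
  fin_dim ('M[R]_(m, n) : normedModType R).
Proof.
pose f (k : 'I_#|{: 'I_m * 'I_n}|) := enum_val k.
exists #|{: 'I_m * 'I_n}|, (fun k => delta_mx (f k).1 (f k).2).
exists (fun k (A : 'M[R]_(m, n)) => A (f k).1 (f k).2); split.
- by move=> i a x y; rewrite !mxE.
- by move=> i; apply: coord_continuous.
- move=> v; rewrite {1}(matrix_sum_delta v) pair_big /=.
  by rewrite (reindex_onto f enum_rank) /=; last (by move=> i _; rewrite /f enum_rankK);
   apply: eq_bigl => k; rewrite /f enum_valK eqxx.
Qed.

#[export] Instance fin_dim_prod (R : realType) (V W : normedModType R) :
  fin_dim V -> fin_dim W -> fin_dim (V * W)%type.
Proof.
move=> [m [e [l [l1 l2 l3]]]] [m' [e' [l' [l1' l2' l3']]]].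
exists (m + m')%N, (fun i => match fintype.split i with inl j => (e j, 0) | inr j => (0, e' j) end : V * W).
exists (fun i (p : V * W) => match fintype.split i with inl j => l j p.1 | inr j => l' j p.2 end); split.
- by move=> i a x y /=; case: fintype.split => j /=; rewrite ?l1 ?l1'.
- move=> i; case: fintype.split => j x.
    by apply: (@continuous_comp _ _ _ fst (l j)); [exact: cvg_fst|exact: l2].
  by apply: (@continuous_comp _ _ _ snd (l' j)); [exact: cvg_snd|exact: l2'].
- move=> [v w]; rewrite big_split_ord /=.
  under eq_bigr do rewrite (unsplitK (inl _)).
  under [X in _ = _ + X]eq_bigr do rewrite (unsplitK (inr _)).
  rewrite [X in _ = X + _](_ : _ = (v, 0)); last first.
    rewrite [v in RHS]l3; elim/big_rec2 : _ => // i y1 y2 _ ->.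
    by congr pair => //=; rewrite scaler0 addr0.
  rewrite [X in _ = _ + X](_ : _ = (0, w)); last first.
    rewrite [w in RHS]l3'; elim/big_rec2 : _ => // i y1 y2 _ ->.
    by congr pair => //=; rewrite scaler0 addr0.
  by congr pair; rewrite /= ?addr0 ?add0r.
Qed.

Section FiniteDimension.
Variables (R : realType) (V V' W : normedModType R).

Lemma continuous_sum (T : topologicalType) m (f : 'I_m -> T -> W) :
  (forall i, continuous (f i)) -> continuous (fun x => \sum_i f i x).
Proof.
move=> fc x.
elim: m f fc => [|m IH] f fc.
  rewrite (_ : (fun y => _) = cst 0); first exact: cst_continuous.
  by apply/funext => y; rewrite big_ord0.
rewrite (_ : (fun y => _) = fun y => f ord0 y + \sum_i f (lift ord0 i) y).
  by apply: continuousD; [exact: fc | apply: IH => i; exact: fc].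
by apply/funext => y; rewrite big_ord_recl.
Qed.

Lemma continuous_linear_sum m (l : 'I_m -> V -> R) (w : 'I_m -> W) :
  (forall i, continuous (l i)) -> continuous (fun v => \sum_i l i v *: w i).
Proof.
by move=> lc; apply: continuous_sum => i v; apply: cvgZr_tmp; exact: lc.
Qed.

(** Continuity of linear maps is what the class [fin_dim] is for: in the expansion of [v] along the
    [e i] only the coordinate functionals depend on [v], and these are continuous by assumption. The
    bilinear case below expands both arguments in the same way. *)
Lemma fin_dim_continuous {fV : fin_dim V} (f : {linear V -> W}) : continuous f.
Proof.
have [m [e [l [_ l2 l3]]]] := fV.
rewrite (_ : (f : V -> W) = fun v => \sum_i l i v *: f (e i)).
  exact: continuous_linear_sum.
by apply/funext => v; rewrite {1}(l3 v) linear_sum; under eq_bigr do rewrite linearZ.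
Qed.

Lemma fin_dim_bilin_continuous {fV : fin_dim V} {fV' : fin_dim V'}
  (f : {bilinear V -> V' -> W}) : continuous (fun p => f p.1 p.2).
Proof.
have [m [e [l [_ l2 l3]]]] := fV.
have [m' [e' [l' [_ l2' l3']]]] := fV'.
rewrite (_ : (fun p => f p.1 p.2) =
    fun p => \sum_i \sum_j (l i p.1 * l' j p.2) *: f (e i) (e' j)); last first.
  apply/funext => -[v w] /=; rewrite {1}(l3 v) linear_sumlz; apply: eq_bigr => i _.
  rewrite {1}(l3' w) linear_sumr; apply: eq_bigr => j _.
  by rewrite linearZl_LR linearZr_LR /= scalerA.
apply: continuous_sum => i; apply: continuous_sum => j p; apply: cvgZr_tmp.
apply: cvgM.
  by apply: (@continuous_comp _ _ _ fst (l i)); [exact: cvg_fst|exact: l2].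
by apply: (@continuous_comp _ _ _ snd (l' j)); [exact: cvg_snd|exact: l2'].
Qed.

End FiniteDimension.

(** * Locality of the differential and rules of calculus *)

Section Differentials.
Variables (R : realType) (V W : normedModType R).

(** Coordinate expressions of maps and sections satisfy their formulas only on open sets of a chart.
    This lemma carries a differential computed from such a formula over to the actual function. *)
Lemma near_eq_is_diff (f g : V -> W) df (x : V) :
  (\near x, f x = g x) -> is_diff x f df -> is_diff x g df.
Proof.
move=> fg [fd fdE].
have E : g \o shift x = cst (g x) + 'd f x +o_ 0 id.
  rewrite -(nbhs_singleton fg).
  have /diff_locally fE := fd.
  apply/eqaddoP => e e0; have /eqaddoP/(_ e e0) := fE.
  have fg0 : \forall y \near (0 : V), f (y + x) = g (y + x).
    by move: fg; rewrite (@near_shift _ _ 0 x) subr0.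
  by apply: filterS2 fg0 => y /= fgy; rewrite !fctE /= fgy.
have fc := diff_continuous fd.
apply: DiffDef; first by apply/diff_locallyP; rewrite (diff_unique fc E).
by rewrite (diff_unique fc E).
Qed.

Lemma near_eq_differentiable (f g : V -> W) (x : V) :
  (\near x, f x = g x) -> differentiable f x -> differentiable g x.
Proof. by move=> fg /differentiableP/(near_eq_is_diff fg)[]. Qed.

Lemma near_eq_diff (f g : V -> W) (x : V) : differentiable f x ->
  (\near x, f x = g x) -> 'd g x = 'd f x :> (V -> W).
Proof. by move=> /differentiableP fd fg; have [_] := near_eq_is_diff fg fd. Qed.

End Differentials.

Section DifferentialRules.
Variables (R : realType) (V W : normedModType R).

Lemma is_diff_linear {fV : fin_dim V} (f : {linear V -> W}) x : is_diff x f f.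
Proof.
have fc : continuous f by exact: fin_dim_continuous.
by apply: DiffDef; [exact: linear_differentiable | rewrite diff_lin].
Qed.

Lemma is_diff_bilin (V1 V2 : normedModType R) {f1 : fin_dim V1} {f2 : fin_dim V2}
    (b : {bilinear V1 -> V2 -> W}) (f df : V -> V1) (g dg : V -> V2) x :
  is_diff x f df -> is_diff x g dg ->
  is_diff x (fun y => b (f y) (g y)) (fun v => b (f x) (dg v) + b (df v) (g x)).
Proof.
move=> fd gd; have bc : continuous (fun p => b p.1 p.2) by exact: fin_dim_bilin_continuous.
have h1 : is_diff (f x, g x) (fun p => b p.1 p.2)
    (fun q => b (f x) q.2 + b q.1 (g x)).
  by apply: DiffDef; [exact: differentiable_bilin|rewrite diff_bilin].
exact: (is_diff_comp (is_diff_pair fd gd) h1).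
Qed.

Lemma is_diff_sum m (f df : 'I_m -> V -> W) x :
  (forall i, is_diff x (f i) (df i)) ->
  is_diff x (fun y => \sum_i f i y) (fun v => \sum_i df i v).
Proof.
elim: m f df => [|m IH] f df fd.
  rewrite (_ : (fun y => _) = cst 0); last by apply/funext => y; rewrite big_ord0.
  rewrite (_ : (fun y => _) = 0); last by apply/funext => y; rewrite big_ord0.
  exact: is_diff_cst.
rewrite (_ : (fun y => _) = f ord0 + (fun y => \sum_i f (lift ord0 i) y)); last first.
  by apply/funext => y; rewrite big_ord_recl.
rewrite [X in is_diff _ _ X](_ : _ = df ord0 + (fun y => \sum_i df (lift ord0 i) y)); last first.
  by apply/funext => y; rewrite big_ord_recl.
by apply: is_diffD; exact: IH.
Qed.

End DifferentialRules.

Section Scaling.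
Variables (R : realType) (W : normedModType R).

(** Scaling is registered as a bilinear map on [R] and [W], so that the product rules for bilinear
    maps cover a function times a section. *)
Definition scale_op (a : R) (w : W) := a *: w.

Fact scale_op_bilinear : bilinear_for
    (GRing.Scale.Law.clone _ _ *:%R _) (GRing.Scale.Law.clone _ _ *:%R _) scale_op.
Proof.
split=> [w|a] k x y /=; rewrite /scale_op.
  by rewrite scalerDl scalerA.
by rewrite scalerDr !scalerA mulrC.
Qed.

HB.instance Definition _ := bilinear_isBilinear.Build R R W W _ _ scale_op
  scale_op_bilinear.

End Scaling.

(** * Closure properties of C^k functions *)

Section ContinuouslyDifferentiable.
Variables (R : realType) (V W : normedModType R).
Implicit Types (U : set V) (f g : V -> W).

Lemma open_near U (x : V) : open U -> U x -> \near x, U x.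
Proof. by move=> oU Ux; exact: open_nbhs_nbhs. Qed.

Lemma cdiff_ext k U f g : open U -> {in U, f =1 g} -> cdiff k U f -> cdiff k U g.
Proof.
move=> oU; elim: k f g => [|k IH] f g fg /=.
  move=> fc x Ux; have xx : nbhs x U by exact: open_nbhs_nbhs.
  rewrite /prop_for /continuous_at -fg ?inE//.
  apply: cvg_trans (fc x Ux); apply: near_eq_cvg.
  by apply: filterS xx => y Uy; rewrite fg ?inE.
move=> [fd dfd].
have fgE x : U x -> \near x, f x = g x.
  by move=> Ux; apply: filterS (open_near oU Ux) => y Uy; rewrite fg ?inE.
split=> [x Ux|v]; first exact: near_eq_differentiable (fgE x Ux) (fd x Ux).
apply: IH (dfd v) => x; rewrite inE => Ux.
by rewrite (near_eq_diff (fd x Ux) (fgE x Ux)).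
Qed.

Lemma cdiff_subset k U U' f : U `<=` U' -> cdiff k U' f -> cdiff k U f.
Proof.
move=> UU'; elim: k f => [|k IH] f /=; first by move=> fc x /UU'; exact: fc.
by move=> [fd dfd]; split=> [x /UU'|v]; [exact: fd | exact: IH].
Qed.

Lemma cdiff_pred k U f : cdiff k.+1 U f -> cdiff k U f.
Proof.
elim: k f => [|k IH] f /= [fd dfd].
  by move=> x Ux; apply: differentiable_continuous; exact: fd.
by split=> // v; apply: IH; exact: dfd.
Qed.

Lemma cdiff_local k U f :
  (forall x, U x -> exists2 U', U' x & cdiff k U' f) -> cdiff k U f.
Proof.
elim: k f => [|k IH] f /= Uf; first by move=> x /Uf[U' U'x]; apply.
split=> [x /Uf[U' U'x [fd _]]|v]; first exact: fd.
by apply: IH => x /Uf[U' U'x [_ dfd]]; exists U'.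
Qed.

Lemma cdiff_cst k U (w : W) : cdiff k U (cst w).
Proof.
elim: k w => [|k IH] w /=; first by move=> x _; exact: cst_continuous.
split=> [x _|v]; first exact: differentiable_cst.
rewrite (_ : (fun x => _) = cst 0); first exact: IH.
by apply/funext => x; rewrite diff_cst.
Qed.

(** The inductive step of the closure proofs below: a formula for the differential, valid on [U]
    only, replaces ['d f], and its regularity is then the induction hypothesis. *)
Lemma cdiff_is_diff k U f (df : V -> V -> W) : open U ->
  (forall x, U x -> is_diff x f (df x)) -> (forall v, cdiff k U (df ^~ v)) ->
  cdiff k.+1 U f.
Proof.
move=> oU fd dfd; split=> [x /fd[] //|v].
apply: cdiff_ext (dfd v) => // x; rewrite inE => /fd dfx.
by rewrite diff_val.
Qed.

Lemma cdiff_diff k U f x : cdiff k.+1 U f -> U x -> is_diff x f ('d f x).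
Proof. by move=> [fd _] /fd; exact: differentiableP. Qed.

Lemma cdiffD k U f g : open U ->
  cdiff k U f -> cdiff k U g -> cdiff k U (fun x => f x + g x).
Proof.
move=> oU; elim: k f g => [|k IH] f g.
  by move=> fc gc x Ux; apply: cvgD; [exact: fc|exact: gc].
move=> fd gd; apply: (@cdiff_is_diff _ _ _ (fun x v => 'd f x v + 'd g x v)) => //.
  move=> x Ux; exact: (is_diffD (cdiff_diff fd Ux) (cdiff_diff gd Ux)).
by move=> v; apply: IH; [exact: fd.2|exact: gd.2].
Qed.

Lemma cdiff_sum k U m (f : 'I_m -> V -> W) : open U ->
  (forall i, cdiff k U (f i)) -> cdiff k U (fun x => \sum_i f i x).
Proof.
move=> oU; elim: m f => [|m IH] f fd.
  rewrite (_ : (fun y => _) = cst 0); first exact: cdiff_cst.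
  by apply/funext => y; rewrite big_ord0.
rewrite (_ : (fun y => _) = fun y => f ord0 y + \sum_i f (lift ord0 i) y); last first.
  by apply/funext => y; rewrite big_ord_recl.
by apply: cdiffD => //; exact: IH.
Qed.

Lemma cdiff_linear k U {fV : fin_dim V} (f : {linear V -> W}) :
  open U -> cdiff k U f.
Proof.
move=> oU; case: k => [|k]; first by move=> x _; exact: fin_dim_continuous.
apply: (@cdiff_is_diff _ _ _ (fun _ => f)) => //.
  by move=> x _; exact: is_diff_linear.
by move=> v; exact: cdiff_cst.
Qed.

End ContinuouslyDifferentiable.

Section ContinuouslyDifferentiableOperations.
Variables (R : realType) (V V1 V2 W : normedModType R).
Implicit Types (U : set V).

Lemma cdiff_bilin k U {f1 : fin_dim V1} {f2 : fin_dim V2}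
    (b : {bilinear V1 -> V2 -> W}) (f : V -> V1) (g : V -> V2) : open U ->
  cdiff k U f -> cdiff k U g -> cdiff k U (fun x => b (f x) (g x)).
Proof.
move=> oU; elim: k f g => [|k IH] f g.
  move=> fc gc x Ux.
  apply: (@continuous_comp _ _ _ (fun x => (f x, g x)) (fun p => b p.1 p.2)).
    by apply: cvg_pair; [exact: fc|exact: gc].
  exact: fin_dim_bilin_continuous.
move=> fd gd.
apply: (@cdiff_is_diff _ _ _ _ _ _ (fun x v => b (f x) ('d g x v) + b ('d f x v) (g x))) => //.
  by move=> x Ux; exact: (is_diff_bilin b (cdiff_diff fd Ux) (cdiff_diff gd Ux)).
move=> v; apply: cdiffD => //; apply: IH.
- exact: cdiff_pred.
- exact: gd.2.
- exact: fd.2.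
- exact: cdiff_pred.
Qed.

Lemma cdiff_pair k U (f : V -> V1) (g : V -> V2) : open U ->
  cdiff k U f -> cdiff k U g -> cdiff k U (fun x => (f x, g x)).
Proof.
move=> oU; elim: k f g => [|k IH] f g.
  by move=> fc gc x Ux; apply: cvg_pair; [exact: fc|exact: gc].
move=> fd gd.
apply: (@cdiff_is_diff _ _ _ _ _ _ (fun x v => ('d f x v, 'd g x v))) => //.
  by move=> x Ux; exact: (is_diff_pair (cdiff_diff fd Ux) (cdiff_diff gd Ux)).
by move=> v; apply: IH; [exact: fd.2|exact: gd.2].
Qed.

Lemma cdiff_linear_comp k U {f1 : fin_dim V1} (L : {linear V1 -> W}) (f : V -> V1) :
  open U -> cdiff k U f -> cdiff k U (fun x => L (f x)).
Proof.
move=> oU; elim: k f => [|k IH] f.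
  by move=> fc x Ux; apply: continuous_comp; [exact: fc|exact: fin_dim_continuous].
move=> fd; apply: (@cdiff_is_diff _ _ _ _ _ _ (fun x v => L ('d f x v))) => //.
  move=> x Ux; exact: (is_diff_comp (cdiff_diff fd Ux) (is_diff_linear L _)).
by move=> v; apply: IH; exact: fd.2.
Qed.

End ContinuouslyDifferentiableOperations.

Lemma cdiff_scale (R : realType) (V W : normedModType R) {fW : fin_dim W} k
    (U : set V) (f : V -> R) (g : V -> W) : open U ->
  cdiff k U f -> cdiff k U g -> cdiff k U (fun x => f x *: g x).
Proof.
move=> oU fd gd.
exact: (@cdiff_bilin R V R W W k U _ _ (@scale_op R W) f g oU fd gd).
Qed.

Lemma cdiff_comp (R : realType) (V V1 W : normedModType R) {f1 : fin_dim V1}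
    {fW : fin_dim W} k (U : set V) (U' : set V1) (f : V -> V1) (g : V1 -> W) :
  open U -> open U' -> (forall x, U x -> U' (f x)) ->
  cdiff k U f -> cdiff k U' g -> cdiff k U (g \o f).
Proof.
move=> oU oU' UU'; elim: k f g UU' => [|k IH] f g UU'.
  move=> fc gc x Ux; apply: continuous_comp; first exact: fc.
  by apply: gc; exact: UU'.
move=> fd gd; have [m [e [l [l1 l2 l3]]]] := f1.
(* In ['d g (f x) ('d f x v)] both the base point and the direction move with [x]. Expanding the
   direction in coordinates leaves ['d g (f x) (e i)], a composite of [f] with a function of class
   C^k, to which the induction hypothesis applies. *)
apply: (@cdiff_is_diff _ _ _ _ _ _ (fun x v => \sum_i l i ('d f x v) *: 'd g (f x) (e i))) => //.
  move=> x Ux.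
  have := is_diff_comp (cdiff_diff fd Ux) (cdiff_diff gd (UU' _ Ux)).
  congr (is_diff _ _ _); apply/funext => v /=.
  by rewrite {1}(l3 ('d f x v)) linear_sum; apply: eq_bigr => i _; rewrite linearZ.
move=> v; apply: cdiff_sum => // i.
pose L : {linear V1 -> R^o} :=
  HB.pack (l i : V1 -> R^o) (GRing.isLinear.Build _ _ _ _ _ (l1 i)).
apply: cdiff_scale => //.
  by apply: (cdiff_linear_comp L) => //; exact: fd.2.
by apply: (IH f (fun y => 'd g y (e i))) => //; [exact: cdiff_pred|exact: gd.2].
Qed.

Section SmoothOperations.
Variables (R : realType) (V W : normedModType R) (U : set V).
Hypothesis oU : open U.

Lemma smooth_on_ext (f g : V -> W) : {in U, f =1 g} ->
  smooth_on U f -> smooth_on U g.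
Proof. by move=> fg fs k; exact: cdiff_ext (fs k). Qed.

Lemma smooth_on_diff (f : V -> W) v : smooth_on U f -> smooth_on U (fun x => 'd f x v).
Proof. by move=> fs k; exact: (fs k.+1).2. Qed.

Lemma smooth_on_is_diff (f : V -> W) x : smooth_on U f -> U x -> is_diff x f ('d f x).
Proof. by move=> /(_ 1%N); exact: cdiff_diff. Qed.

Lemma smooth_on_cst (w : W) : smooth_on U (cst w).
Proof. by move=> k; exact: cdiff_cst. Qed.

Lemma smooth_onD (f g : V -> W) : smooth_on U f -> smooth_on U g ->
  smooth_on U (fun x => f x + g x).
Proof. by move=> fs gs k; exact: cdiffD. Qed.

Lemma smooth_on_sum m (f : 'I_m -> V -> W) : (forall i, smooth_on U (f i)) ->
  smooth_on U (fun x => \sum_i f i x).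
Proof. by move=> fs k; apply: cdiff_sum => // i; exact: fs. Qed.

Lemma smooth_on_linear {fV : fin_dim V} (f : {linear V -> W}) : smooth_on U f.
Proof. by move=> k; exact: cdiff_linear. Qed.

Lemma smooth_on_linear_comp (V1 : normedModType R) {f1 : fin_dim V1}
  (L : {linear V1 -> W}) (f : V -> V1) : smooth_on U f -> smooth_on U (fun x => L (f x)).
Proof. by move=> fs k; exact: cdiff_linear_comp. Qed.

Lemma smooth_on_pair (V1 V2 : normedModType R) (f : V -> V1) (g : V -> V2) :
  smooth_on U f -> smooth_on U g -> smooth_on U (fun x => (f x, g x)).
Proof. by move=> fs gs k; exact: cdiff_pair. Qed.

Lemma smooth_on_scale {fW : fin_dim W} (f : V -> R) (g : V -> W) :
  smooth_on U f -> smooth_on U g -> smooth_on U (fun x => f x *: g x).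
Proof. by move=> fs gs k; exact: cdiff_scale. Qed.

Lemma smooth_on_comp (V1 : normedModType R) {f1 : fin_dim V1} {fW : fin_dim W}
    (U' : set V1) (f : V -> V1) (g : V1 -> W) :
  open U' -> (forall x, U x -> U' (f x)) ->
  smooth_on U f -> smooth_on U' g -> smooth_on U (fun x => g (f x)).
Proof. by move=> oU' UU' fs gs k; exact: (cdiff_comp oU oU'). Qed.

Lemma smooth_on_mulmx m p q (f : V -> 'M[R]_(m, p)) (g : V -> 'M[R]_(p, q)) :
  smooth_on U f -> smooth_on U g -> smooth_on U (fun x => f x *m g x).
Proof. by move=> fs gs k; exact: (@cdiff_bilin _ _ _ _ _ _ _ _ _ (@mulmx R m p q)). Qed.

End SmoothOperations.

Lemma smooth_on_local (R : realType) (V W : normedModType R) (U : set V) (f : V -> W) :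
  (forall x, U x -> exists2 U', U' x & smooth_on U' f) -> smooth_on U f.
Proof.
by move=> Uf k; apply: cdiff_local => x /Uf[U' U'x fs]; exists U'.
Qed.

Lemma smooth_on_subset (R : realType) (V W : normedModType R) (U U' : set V) (f : V -> W) :
  U `<=` U' -> smooth_on U' f -> smooth_on U f.
Proof. by move=> UU' fs k; exact: cdiff_subset (fs k). Qed.

Lemma smooth_on_continuous (R : realType) (V W : normedModType R) (U : set V) (f : V -> W) x :
  smooth_on U f -> U x -> {for x, continuous f}.
Proof. by move=> /(_ 0%N); apply. Qed.

Lemma smooth_on_jacobian (R : realType) m n (U : set 'rV[R]_m) (f : 'rV[R]_m -> 'rV[R]_n) :
  open U -> smooth_on U f -> smooth_on U (jacobian f).
Proof.
move=> oU fs.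
(* The Jacobian assembled from its rows, each of which is a differential in a fixed direction and
   hence smooth by the definition of [cdiff]. *)
pose J x := \sum_(i < m) (delta_mx i 0 : 'cV[R]_m) *m 'd f x (delta_mx 0 i).
apply: (@smooth_on_ext _ _ _ _ oU J); last first.
  apply: smooth_on_sum => // i; apply: smooth_on_mulmx => //.
    exact: smooth_on_cst.
  exact: smooth_on_diff.
move=> x _; apply/row_matrixP => i.
rewrite /J linear_sum (bigD1 i) //= big1 ?addr0; last first.
  move=> k ki; apply/rowP => j; rewrite !mxE big_ord1 !mxE.
  by rewrite eq_sym (negbTE ki) mul0r.
apply/rowP => j; rewrite !mxE big_ord1 !mxE !eqxx mul1r.
by [].
Qed.

(** * Symmetry of second derivatives *)

Section SecondDerivative.
Variables (R : realType) (V : normedModType R).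

Lemma is_derive_line (W : normedModType R) (f : V -> W) (x u : V) (s : R) :
  differentiable f (x + s *: u) ->
  is_derive s 1 (fun t => f (x + t *: u)) ('d f (x + s *: u) u).
Proof.
move=> /differentiableP fd.
have ld : is_diff s (fun t : R => x + t *: u) (fun t => t *: u).
  have := is_diffD (is_diff_cst x s) (is_diff_scalel s u).
  by congr (is_diff _ _ _); apply/funext => t; rewrite !fctE ?add0r.
have cd : is_diff s (fun t : R => f (x + t *: u)) ('d f (x + s *: u) \o ( *:%R^~ u)).
  exact: (is_diff_comp ld fd).
have [cd1 cd2] := cd.
by apply: DeriveDef; [exact: diff_derivable | rewrite deriveE// cd2 /= scale1r].
Qed.

(** The second difference is the increment over [[0, h]] of [s |-> f (x + h v + s u) - f (x + s u)].
    By the mean value theorem it equals [h] times the difference of [A = 'd f _ u] at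
    [x + h v + s u] and at [x + s u], for some [s] between [0] and [h]. Expanding both values of [A]
    to first order at [x], the contributions of [s u] cancel and [h 'd A x v] remains. *)
Lemma second_difference (f : V -> R) (x u v : V) :
  (\forall y \near x, differentiable f y) -> differentiable (fun y => 'd f y u) x ->
  forall e, 0 < e -> \forall h \near 0^'+,
   `|f (x + h *: v + h *: u) - f (x + h *: u) - f (x + h *: v) + f x
       - h ^+ 2 * 'd (fun y => 'd f y u) x v| <= e * h ^+ 2.
Proof.
move=> fd Ad e e0.
pose A y := 'd f y u.
(* For [0 <= s <= h] the displacements [h v + s u] and [s u] have norms adding up to at most [h c].
   The first-order expansions are taken with error [e / c], so that the total error is [e h^2]; the
   summand [1] keeps [c] positive. *)
pose c := 2 * `|u| + `|v| + 1.
have c0 : 0 < c by rewrite ltr_wpDl // addr_ge0 // mulr_ge0.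
have /diff_locallyP[_] := Ad; move=> /eqaddoP /(_ (e / c)).
rewrite divr_gt0 // => /(_ isT).
rewrite nearE => /nbhs_ballP[d1 /= d10 Hd1].
move: fd => /nbhs_ballP[d2 /= d20 Hd2].
near=> h.
have h0 : 0 < h by near: h; exact: nbhs_right_gt.
have hd1 : h * c < d1.
  by rewrite -ltr_pdivlMr//; near: h; apply: nbhs_right_lt; rewrite divr_gt0.
have hd2 : h * c < d2.
  by rewrite -ltr_pdivlMr//; near: h; apply: nbhs_right_lt; rewrite divr_gt0.
have small s : 0 <= s <= h ->
    [/\ `|h *: v + s *: u| < h * c, `|s *: u| < h * c
      & `|h *: v + s *: u| + `|s *: u| <= h * c].
  move=> /andP[s0 sh]; have : `|s *: u| <= h * `|u|.
    by rewrite normrZ ger0_norm // ler_wpM2r.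
  have : `|h *: v + s *: u| <= h * `|v| + `|s *: u|.
    by rewrite (le_trans (ler_normD _ _)) // [`|h *: v|]normrZ gtr0_norm.
  have : 0 <= h * `|u| by rewrite mulr_ge0 // ltW.
  have : 0 <= h * `|v| by rewrite mulr_ge0 // ltW.
  rewrite /c; move: `|u| `|v| `|_ + _| `|_ *: _| => a b p q b0 a0 H1 H2.
  by split; lra.
have ballx (w : V) : `|w| < d2 -> ball x d2 (x + w).
  by rewrite -ball_normE /= opprD addrA subrr sub0r normrN.
pose g s := f (x + h *: v + s *: u) - f (x + s *: u).
pose dg s := A (x + h *: v + s *: u) - A (x + s *: u).
have gd s : 0 <= s <= h -> is_derive s 1 g (dg s).
  move=> /small[s1 s2 _]; apply: is_deriveB; apply: is_derive_line; apply: Hd2.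
    by rewrite -addrA; apply: ballx; exact: lt_trans hd2.
  by apply: ballx; exact: lt_trans hd2.
have [||s sh] := @MVT R g dg 0 h h0.
- by move=> s; rewrite in_itv /= => /andP[/ltW s0 /ltW sh]; apply: gd; rewrite s0.
- apply: derivable_within_continuous => s; rewrite in_itv /= => sh.
  by have [] := gd s sh.
rewrite /g scale0r !addr0 subr0 => gE.
have [s1 s2 s3] : [/\ `|h *: v + s *: u| < h * c, `|s *: u| < h * c
      & `|h *: v + s *: u| + `|s *: u| <= h * c].
  by apply: small; move: sh; rewrite in_itv /= => /andP[/ltW -> /ltW ->].
have taylor k : `|k| < h * c ->
    `|A (x + k) - A x - 'd A x k| <= e / c * `|k|.
  move=> kc; have := Hd1 k; rewrite -ball_normE /= sub0r normrN !fctE /=.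
  by rewrite opprD addrA [k + x]addrC; apply; exact: lt_trans hd1.
have H1 := taylor _ s1; have H2 := taylor _ s2.
rewrite [X in `|X|](_ : _ - h ^+ 2 * 'd A x v =
    h * ((A (x + (h *: v + s *: u)) - A x - 'd A x (h *: v + s *: u))
    - (A (x + s *: u) - A x - 'd A x (s *: u)))); last first.
  have -> : 'd A x (h *: v + s *: u) = h * 'd A x v + 'd A x (s *: u).
    by rewrite linearD linearZ.
  rewrite [x + (h *: v + _)]addrA.
  have -> : f (x + h *: v + h *: u) - f (x + h *: u) - f (x + h *: v) + f x = dg s * h.
    by rewrite -gE opprD opprK addrA.
  rewrite /dg; ring.
rewrite normrM gtr0_norm //.
apply: (@le_trans _ _ (h * (e / c * (h * c)))); last first.
  rewrite [leLHS](_ : _ = e * h ^+ 2) //; field.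
  by rewrite gt_eqF.
apply: ler_wpM2l; first exact: ltW.
apply: (le_trans (ler_normB _ _)); apply: (le_trans (lerD H1 H2)).
by rewrite -mulrDr; apply: ler_wpM2l => //; rewrite ltW// divr_gt0.
Unshelve. all: by end_near. Qed.

(** The second difference is symmetric in [u] and [v], so [h^2] times either mixed derivative is
    within [e / 2 * h^2] of the same number; dividing by [h^2] makes the two derivatives [e]-close
    for every [e]. *)
Lemma second_differential_sym (f : V -> R) (x u v : V) :
  (\forall y \near x, differentiable f y) ->
  differentiable (fun y => 'd f y u) x -> differentiable (fun y => 'd f y v) x ->
  'd (fun y => 'd f y u) x v = 'd (fun y => 'd f y v) x u.
Proof.
move=> fd ud vd; apply/eqP; rewrite -subr_eq0 -normr_le0; apply/ler_addgt0Pr => e e0.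
have e2 : 0 < e / 2 by rewrite divr_gt0.
near (0 : R)^'+ => h.
have h0 : 0 < h by near: h; exact: nbhs_right_gt.
have : `|f (x + h *: v + h *: u) - f (x + h *: u) - f (x + h *: v) + f x
       - h ^+ 2 * 'd (fun y => 'd f y u) x v| <= e / 2 * h ^+ 2.
  by near: h; exact: second_difference.
have : `|f (x + h *: u + h *: v) - f (x + h *: v) - f (x + h *: u) + f x
       - h ^+ 2 * 'd (fun y => 'd f y v) x u| <= e / 2 * h ^+ 2.
  by near: h; exact: second_difference.
rewrite add0r [x + h *: u + _]addrAC.
set P := 'd _ x u; set Q := 'd _ x v.
rewrite !ler_norml => /andP[H1 H2] /andP[H3 H4].
have h20 : 0 < h ^+ 2 by rewrite exprn_gt0.
move: (h ^+ 2) h20 H1 H2 H3 H4 => k k0 H1 H2 H3 H4.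
by apply/andP; split; rewrite -(ler_pM2l k0); lra.
Unshelve. all: by end_near. Qed.

End SecondDerivative.

(** The scalar statement rests on the mean value theorem, so it is applied to each coordinate, a
    linear functional that commutes with both differentials. *)
Lemma smooth_on_diff_sym (R : realType) (V : normedModType R) n (U : set V)
    (f : V -> 'rV[R]_n) (x u v : V) : open U -> smooth_on U f -> U x ->
  'd (fun y => 'd f y u) x v = 'd (fun y => 'd f y v) x u.
Proof.
move=> oU fs Ux; apply/rowP => j.
pose l (w : 'rV[R]_n) : R := w 0 j.
have ll : linear (l : _ -> R^o) by move=> a w w'; rewrite /l !mxE.
pose L : {linear 'rV[R]_n -> R^o} := HB.pack (l : _ -> R^o) (GRing.isLinear.Build _ _ _ _ _ ll).
have ls (g : V -> 'rV[R]_n) : smooth_on U g -> smooth_on U (fun y => l (g y)).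
  by move=> gs; apply: (smooth_on_linear_comp oU L).
have lE (g : V -> 'rV[R]_n) y w : smooth_on U g -> U y ->
    'd (fun y => l (g y)) y w = l ('d g y w).
  move=> gs Uy.
  have [_ ->] := is_diff_comp (smooth_on_is_diff gs Uy) (is_diff_linear L (g y)).
  by [].
have lE2 w w' : 'd (fun y => 'd (fun y => l (f y)) y w) x w' =
    l ('d (fun y => 'd f y w) x w').
  have sw := smooth_on_diff w fs.
  rewrite -lE //.
  suff -> : 'd (fun y => 'd (fun y => l (f y)) y w) x =
    'd (fun y => l ('d f y w)) x :> (V -> R) by [].
  apply: near_eq_diff.
    by have [] := smooth_on_is_diff (ls _ sw) Ux.
  by apply: filterS (open_near oU Ux) => y Uy; rewrite lE.
rewrite -[LHS]/(l _) -[RHS]/(l _) -!lE2.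
have slf := ls _ fs.
apply: second_differential_sym.
- by apply: filterS (open_near oU Ux) => y Uy; have [] := smooth_on_is_diff slf Uy.
- by have [] := smooth_on_is_diff (smooth_on_diff u slf) Ux.
- by have [] := smooth_on_is_diff (smooth_on_diff v slf) Ux.
Qed.

(** * Charts and smooth maps *)

Lemma open_setI_preimage (T T' : topologicalType) (U : set T) (U' : set T') (f : T -> T') :
  open U -> open U' -> (forall x, U x -> {for x, continuous f}) ->
  open (U `&` f @^-1` U').
Proof.
move=> oU oU' fc; rewrite openE => x [Ux U'fx]; rewrite /interior.
apply: filterI; first exact: open_nbhs_nbhs.
by apply: fc => //; exact: open_nbhs_nbhs.
Qed.

Section SmoothMaps.
Variable R : realType.

Definition chart_dom (T T' : Type) (V V' : normedModType R) (c : chart T V)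
    (c' : chart T' V') (f : T -> T') : set V :=
  to c @` (source c `&` f @^-1` source c').

(** What [atlas M] and [bundle_atlas M] have in common. The set [T] carries no topology here:
    openness of overlaps and smoothness of transitions are both contained in [smooth_map A A id],
    which makes one theory serve for [M] and for the total space. *)
Definition smooth_atlas (T : Type) (V : normedModType R) (A : set (chart T V)) : Prop :=
  [/\ forall p, exists2 c, A c & source c p,
      forall c p, A c -> source c p -> from c (to c p) = p
    & smooth_map A A id].

Lemma chart_domP (T T' : Type) (V V' : normedModType R) (A : set (chart T V))
    (c : chart T V) (c' : chart T' V') (f : T -> T') x :
  smooth_atlas A -> A c -> chart_dom c c' f x ->
  exists p, [/\ to c p = x, from c x = p, source c p & source c' (f p)].
Proof.
by move=> [_ cK _] Ac [p [cp c'fp] <-]; exists p; split=> //; exact: cK.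
Qed.

(** Near each point an arbitrary pair of charts is compared with the given pair by transition maps
    on both sides. Openness of the domain has to be obtained as well: the set [N] is an iterated
    preimage of open sets under continuous maps. *)
Lemma smooth_map_local (T T' : Type) (V V' : normedModType R) {fV : fin_dim V}
    {fV' : fin_dim V'} (A : set (chart T V)) (A' : set (chart T' V')) (f : T -> T') :
  smooth_atlas A -> smooth_atlas A' ->
  (forall p, exists c c' U, [/\ A c, A' c', source c p,
     open U & [/\ U (to c p), U `<=` chart_dom c c' f
              & smooth_on U (to c' \o f \o from c)]]) ->
  smooth_map A A' f.
Proof.
move=> sA sA' Hf c1 c1' Ac1 Ac1'; rewrite -/(chart_dom c1 c1' f) => W.
have [_ cK sid] := sA; have [_ cK' sid'] := sA'.
have H x : W x -> exists N, [/\ open N, N x, N `<=` W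
    & smooth_on N (to c1' \o f \o from c1)].
  move=> Wx; have [p [cpx cxp c1p c1'p]] := chart_domP sA Ac1 Wx.
  have [c [c' [U [Ac Ac' cp oU [Up UW fs]]]]] := Hf p.
  have [/= o1 s1] := sid _ _ Ac1 Ac; have [/= o2 s2] := sid' _ _ Ac' Ac1'.
  set D1 := to c1 @` _ in o1 s1; set D2 := to c' @` _ in o2 s2.
  pose N2 := U `&` (to c' \o f \o from c) @^-1` D2.
  have oN2 : open N2.
    by apply: open_setI_preimage => // y; exact: smooth_on_continuous.
  pose N := D1 `&` (to c \o id \o from c1) @^-1` N2.
  have oN : open N.
    by apply: open_setI_preimage => // y; exact: smooth_on_continuous.
  have NP y : N y -> exists q, [/\ to c1 q = y, from c1 y = q, source c1 q,
      from c (to c q) = q & [/\ from c' (to c' (f q)) = f q, source c' (f q) & source c1' (f q)]].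
    move=> [[q [c1q cq] <-{y}]]; rewrite /= /N2 /= cK // => -[/= /UW].
    move=> /(chart_domP sA Ac)[_ [_ <- _ c'q]]; rewrite cK // in c'q *.
    move=> [r [c'r c1'r]] rq.
    have fqr : f q = r by rewrite -(cK' _ _ Ac' c'q) -rq cK'.
    by exists q; rewrite !cK ?cK' // fqr.
  exists N; split=> //.
  - split; first by exists p.
    rewrite /= /N2 /= cxp; split=> //=; rewrite cK //.
    exists (f p) => //; split=> //.
    by have /(chart_domP sA Ac)[q [_]] := UW _ Up; rewrite cK // => <-.
  - by move=> y /NP[q [<- _ c1q _ [_ _ c1'q]]]; exists q.
  - apply: (@smooth_on_ext _ _ _ _ oN
       ((to c1' \o id \o from c') \o ((to c' \o f \o from c) \o (to c \o id \o from c1)))).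
      move=> y; rewrite inE => /NP[q [_ /= -> _ -> [-> _ _]]] //.
    apply: (@smooth_on_comp _ _ _ _ oN _ _ _ D2) => //.
      by move=> y [_ []].
    apply: (@smooth_on_comp _ _ _ _ oN _ _ _ U) => //.
      by move=> y [_ []].
    by apply: smooth_on_subset s1 => y [].
split.
  rewrite openE => x /H[N [oN Nx NW _]].
  by apply: filterS NW _; exact: open_nbhs_nbhs.
by apply: smooth_on_local => x /H[N [oN Nx NW fs]]; exists N.
Qed.

Lemma smooth_map_comp (T T' T'' : Type) (V V' V'' : normedModType R)
    {fV : fin_dim V} {fV' : fin_dim V'} {fV'' : fin_dim V''}
    (A : set (chart T V)) (A' : set (chart T' V')) (A'' : set (chart T'' V''))
    (f : T -> T') (g : T' -> T'') :
  smooth_atlas A -> smooth_atlas A' -> smooth_atlas A'' ->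
  smooth_map A A' f -> smooth_map A' A'' g -> smooth_map A A'' (g \o f).
Proof.
move=> sA sA' sA'' fs gs; apply: smooth_map_local => // p.
have [cA cK _] := sA; have [cA' cK' _] := sA'; have [cA'' cK'' _] := sA''.
have [c Ac cp] := cA p; have [c' Ac' cp'] := cA' (f p).
have [c'' Ac'' cp''] := cA'' (g (f p)).
have [/= o1 s1] := fs _ _ Ac Ac'; have [/= o2 s2] := gs _ _ Ac' Ac''.
rewrite -/(chart_dom _ _ _) in o1 s1; rewrite -/(chart_dom _ _ _) in o2 s2.
pose N := chart_dom c c' f `&` (to c' \o f \o from c) @^-1` chart_dom c' c'' g.
have oN : open N.
  by apply: open_setI_preimage => // y; exact: smooth_on_continuous.
have NP y : N y -> exists q, [/\ to c q = y, from c y = q, source c q,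
    from c' (to c' (f q)) = f q & source c'' (g (f q))].
  move=> [/(chart_domP sA Ac)[q [cq cy sq sfq]]]; rewrite /= cy.
  by move=> /(chart_domP sA' Ac')[r [_]]; rewrite cK' // => <- _ h; exists q; rewrite cK'.
exists c, c'', N; split=> //; split.
- by split; [exists p|rewrite /= cK //; exists (f p)].
- by move=> y /NP[q [<- _ sq _ sgq]]; exists q.
- apply: (@smooth_on_ext _ _ _ _ oN
     ((to c'' \o g \o from c') \o (to c' \o f \o from c))).
    by move=> y; rewrite inE => /NP[q [_ /= -> _ -> _]].
  apply: (@smooth_on_comp _ _ _ _ oN _ _ _ (chart_dom c' c'' g)) => //.
    by move=> y [].
  by apply: smooth_on_subset s1 => y [].
Qed.

Lemma diffeomorphism_comp (T T' T'' : Type) (V V' V'' : normedModType R)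
    {fV : fin_dim V} {fV' : fin_dim V'} {fV'' : fin_dim V''}
    (A : set (chart T V)) (A' : set (chart T' V')) (A'' : set (chart T'' V''))
    (f : T -> T') (g : T' -> T'') :
  smooth_atlas A -> smooth_atlas A' -> smooth_atlas A'' ->
  diffeomorphism A A' f -> diffeomorphism A' A'' g -> diffeomorphism A A'' (g \o f).
Proof.
move=> sA sA' sA'' [fs [f' [fs' fK f'K]]] [gs [g' [gs' gK g'K]]].
split; first exact: (smooth_map_comp sA sA' sA'').
exists (f' \o g'); split.
- exact: (smooth_map_comp sA'' sA' sA).
- exact: can_comp.
- exact: can_comp.
Qed.

End SmoothMaps.

Lemma mulmx_ext (R : pzRingType) m n (A B : 'M[R]_(m, n)) :
  (forall v : 'rV_m, v *m A = v *m B) -> A = B.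
Proof. by move=> AB; apply/row_matrixP => i; rewrite !rowE. Qed.

Lemma mul_jacobian (R : realType) m n (f df : 'rV[R]_m -> 'rV[R]_n) x v :
  is_diff x f df -> v *m jacobian f x = df v.
Proof. by move=> [_ fE]; rewrite /jacobian mul_rV_lin1 fE. Qed.

(** * Jacobians between charts *)

Section ManifoldCharts.
Variables (R : realType) (n : nat) (M : manifold R n).
Implicit Types (c : chart M 'rV[R]_n) (p : M).

Lemma atlas_smooth : smooth_atlas (atlas M).
Proof.
split; first exact: atlas_cover.
- by move=> c p /atlas_chart[_ _ cK _ _]; exact: cK.
- move=> c c' Ac Ac'; split; last exact: atlas_compatible.
  have [oc ot cK ct cf] := atlas_chart Ac; have [oc' _ _ _ _] := atlas_chart Ac'.
  rewrite (_ : _ @` _ = target c `&` from c @^-1` source c').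
    exact: open_setI_preimage.
  apply/seteqP; split=> [_ [p [cp c'p] <-]|_ [[p cp <-]]] /=.
    by split; [exists p | rewrite /= cK].
  by rewrite cK // => c'p; exists p.
Qed.

(** The derivative of [f] at [p] read in two chosen charts. With [f = id] it is the matrix of a
    change of coordinates, so tangent maps and chart changes obey the single composition law
    [dm_comp]. *)
Definition dm (f : M -> M) c c' p := jacobian (to c' \o f \o from c) (to c p).

Lemma dm_comp (f g : M -> M) c c' c'' p :
  smooth_map (atlas M) (atlas M) f -> smooth_map (atlas M) (atlas M) g ->
  atlas M c -> atlas M c' -> atlas M c'' ->
  source c p -> source c' (f p) -> source c'' (g (f p)) ->
  dm (g \o f) c c'' p = dm f c c' p *m dm g c' c'' (f p).
Proof.
move=> fs gs Ac Ac' Ac'' cp c'p c''p.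
have [_ cK _] := atlas_smooth.
have [/= o1 s1] := fs _ _ Ac Ac'; have [/= o2 s2] := gs _ _ Ac' Ac''.
rewrite -/(chart_dom _ _ _) in o1 s1; rewrite -/(chart_dom _ _ _) in o2 s2.
have d1 : is_diff (to c p) (to c' \o f \o from c) ('d (to c' \o f \o from c) (to c p)).
  by apply: (smooth_on_is_diff s1); exists p.
have d2 : is_diff (to c' (f p)) (to c'' \o g \o from c')
    ('d (to c'' \o g \o from c') (to c' (f p))).
  by apply: (smooth_on_is_diff s2); exists (f p).
have d3 : is_diff (to c p) (to c'' \o (g \o f) \o from c)
   ('d (to c'' \o g \o from c') (to c' (f p)) \o 'd (to c' \o f \o from c) (to c p)).
  have E : (to c' \o f \o from c) (to c p) = to c' (f p) by rewrite /= cK.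
  rewrite -E in d2 *; apply: near_eq_is_diff (is_diff_comp d1 d2).
  have : \forall y \near to c p, chart_dom c c' f y.
    by apply: open_nbhs_nbhs; split=> //; exists p.
  apply: filterS => y /(chart_domP atlas_smooth Ac)[q [_ /= -> _ c'q]].
  by rewrite cK.
apply: mulmx_ext => v; apply: (etrans (mul_jacobian v d3)); rewrite mulmxA.
apply: esym; apply: (etrans (congr1 (mulmx^~ _) (mul_jacobian v d1))).
exact: (mul_jacobian _ d2).
Qed.

Lemma dm_id c p : atlas M c -> source c p -> dm id c c p = 1%:M.
Proof.
move=> Ac cp; have [_ cK sid] := atlas_smooth.
have [/= oU _] := sid _ _ Ac Ac; rewrite -/(chart_dom c c id) in oU.
have d : is_diff (to c p) (to c \o id \o from c) id.
  apply: near_eq_is_diff (is_diff_id _).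
  have : \forall y \near to c p, chart_dom c c id y.
    by apply: open_nbhs_nbhs; split=> //; exists p.
  by apply: filterS => y /(chart_domP atlas_smooth Ac)[q [/= <- /= -> _ _]].
by apply: mulmx_ext => v; apply: (etrans (mul_jacobian v d)); rewrite mulmx1.
Qed.

Lemma chart_atP p : atlas M (chart_at p) /\ source (chart_at p) p.
Proof. by rewrite /chart_at; case: cid2. Qed.

Lemma vec_changeE c c' p v : vec_change c c' (to c p) v = v *m dm id c c' p.
Proof. by []. Qed.

Lemma cov_changeE c c' p xi : atlas M c -> source c p ->
  cov_change c c' (to c p) xi = dm id c' c p *m xi.
Proof.
move=> Ac cp; have [_ cK _] := atlas_smooth.
by rewrite /cov_change /transition /= cK.
Qed.

Lemma tangentE f p : tangent f p = dm f (chart_at p) (chart_at (f p)) p.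
Proof. by []. Qed.

End ManifoldCharts.

(** * The bundle T + T^* *)

(* Comparing two different Jacobians by unfolding takes forever. *)
Local Opaque jacobian chart_at mulmx.
Lemma pair3_eq (A B C : Type) (a a' : A) (b b' : B) (d d' : C) :
  a = a' -> b = b' -> d = d' -> (a, (b, d)) = (a', (b', d')).
Proof. by move=> -> -> ->. Qed.

Lemma invmx_mul (R : comUnitRingType) n (A B : 'M[R]_n) :
  A \in unitmx -> B \in unitmx -> invmx (A *m B) = invmx B *m invmx A.
Proof.
move=> uA uB; have uAB : A *m B \in unitmx by rewrite unitmx_mul uA.
by rewrite -[RHS](mulKmx uAB) -mulmxA (mulmxA B) mulmxV // mul1mx mulmxV ?mulmx1.
Qed.

Section BundleMaps.
Variables (R : realType) (n : nat) (M : manifold R n).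
Implicit Types (c : chart M 'rV[R]_n) (p : M) (f g : M -> M).

Local Notation smoothM := (smooth_map (atlas M) (atlas M)).

Lemma smooth_id : smoothM id.
Proof. by have [] := atlas_smooth M. Qed.

Lemma atlasK c p : atlas M c -> source c p -> from c (to c p) = p.
Proof. by have [_ cK _] := atlas_smooth M; exact: cK. Qed.

Lemma dm_inv f g c c' p : smoothM f -> smoothM g -> cancel f g ->
  atlas M c -> atlas M c' -> source c p -> source c' (f p) ->
  dm f c c' p *m dm g c' c (f p) = 1%:M.
Proof.
move=> fs gs fK Ac Ac' cp c'p.
have gfp : source c (g (f p)) by rewrite fK.
rewrite -(dm_comp fs gs Ac Ac' Ac cp c'p gfp).
rewrite (_ : g \o f = id); first exact: dm_id.
by apply/funext => q; exact: fK.
Qed.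

Lemma dm_invmx f g c c' p : smoothM f -> smoothM g -> cancel f g -> cancel g f ->
  atlas M c -> atlas M c' -> source c p -> source c' (f p) ->
  dm f c c' p \in unitmx /\ invmx (dm f c c' p) = dm g c' c (f p).
Proof.
move=> fs gs fK gK Ac Ac' cp c'p.
have E := dm_inv fs gs fK Ac Ac' cp c'p.
have [u1 _] := mulmx1_unit E; split=> //.
by rewrite -[RHS](mulKmx u1) E mulmx1.
Qed.

Lemma dm_trans c c' c'' p : atlas M c -> atlas M c' -> atlas M c'' ->
  source c p -> source c' p -> source c'' p ->
  dm id c c' p *m dm id c' c'' p = dm id c c'' p.
Proof.
move=> Ac Ac' Ac'' cp c'p c''p.
by apply: esym; apply: (@dm_comp _ _ _ id id) => //; exact: smooth_id.
Qed.

Lemma dm_transl f c c1 c' p : smoothM f -> atlas M c -> atlas M c1 -> atlas M c' ->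
  source c p -> source c1 p -> source c' (f p) ->
  dm id c c1 p *m dm f c1 c' p = dm f c c' p.
Proof. by move=> fs Ac Ac1 Ac' cp c1p c'p; apply: esym; exact: (dm_comp smooth_id). Qed.

Lemma dm_transr f c c1 c' p : smoothM f -> atlas M c -> atlas M c1 -> atlas M c' ->
  source c p -> source c1 (f p) -> source c' (f p) ->
  dm f c c1 p *m dm id c1 c' (f p) = dm f c c' p.
Proof.
move=> fs Ac Ac1 Ac' cp c1p c'p; apply: esym.
exact: (dm_comp fs smooth_id).
Qed.

Lemma dm_transK c c' p : atlas M c -> atlas M c' -> source c p -> source c' p ->
  dm id c c' p *m dm id c' c p = 1%:M.
Proof. by move=> Ac Ac' cp c'p; rewrite (dm_trans Ac Ac' Ac) //; exact: dm_id. Qed.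

Lemma bundle_chart_from c p (v : fibre R n) : atlas M c -> source c p ->
  from (bundle_chart c) (to c p, v) =
  (p, (v.1 *m dm id c (chart_at p) p, dm id (chart_at p) c p *m v.2)) :> total_space M.
Proof.
move=> Ac cp; have [Ap pp] := chart_atP p.
by rewrite /= (atlasK Ac cp) vec_changeE (cov_changeE _ _ Ac cp).
Qed.

Lemma bundle_chart_to c p (v : fibre R n) :
  to (bundle_chart c) ((p, v) : total_space M) =
  (to c p, (v.1 *m dm id (chart_at p) c p, dm id c (chart_at p) p *m v.2)).
Proof.
by have [Ap pp] := chart_atP p; rewrite /= /pos vec_changeE (cov_changeE _ _ Ap pp).
Qed.

Lemma bundle_chartK c p (v : fibre R n) : atlas M c -> source c p ->
  from (bundle_chart c) (to (bundle_chart c) ((p, v) : total_space M)) = (p, v).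
Proof.
move=> Ac cp; have [Ap pp] := chart_atP p.
rewrite bundle_chart_to (bundle_chart_from _ Ac cp) /= -(mulmxA v.1) (mulmxA _ _ v.2).
rewrite (dm_transK Ap Ac pp cp).
by rewrite mulmx1 mul1mx; case: v.
Qed.

Lemma bundle_chart_fromK c p (v : fibre R n) : atlas M c -> source c p ->
  to (bundle_chart c) (from (bundle_chart c) (to c p, v)) = (to c p, v).
Proof.
move=> Ac cp; have [Ap pp] := chart_atP p.
rewrite (bundle_chart_from _ Ac cp) bundle_chart_to /= -(mulmxA v.1) (mulmxA _ _ v.2).
rewrite (dm_transK Ac Ap cp pp).
by rewrite mulmx1 mul1mx; case: v.
Qed.

Lemma bundle_chart_dom f (F : total_space M -> total_space M) c c' :
  atlas M c -> (forall e, (F e).1 = f e.1) ->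
  chart_dom (bundle_chart c) (bundle_chart c') F = [set y | chart_dom c c' f y.1].
Proof.
move=> Ac Ff; apply/seteqP; split=> [_ [e [/= ce c'e] <-]|[x v] /= [p [cp c'p] <-{x}]].
  by exists e.1 => //; split=> //=; rewrite -Ff.
exists (from (bundle_chart c) (to c p, v)); last exact: bundle_chart_fromK.
by by rewrite (bundle_chart_from _ Ac cp); split=> //=; rewrite Ff.
Qed.

Lemma open_fst_preimage (U : set 'rV[R]_n) : open U ->
  open [set y : 'rV[R]_n * fibre R n | U y.1].
Proof. by move=> oU; apply: open_comp => // y _; exact: cvg_fst. Qed.

Lemma smooth_on_fst_comp (W : normedModType R) {fW : fin_dim W} (U : set 'rV[R]_n)
    (h : 'rV[R]_n -> W) : open U -> smooth_on U h ->
  smooth_on [set y : 'rV[R]_n * fibre R n | U y.1] (fun y => h y.1).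
Proof.
move=> oU hs.
apply: (smooth_on_comp (open_fst_preimage oU) (f := fst) oU) => //.
exact: (smooth_on_linear (open_fst_preimage oU) fst).
Qed.

Lemma smooth_on_fibre_map (U : set 'rV[R]_n) (a : 'rV[R]_n -> 'rV[R]_n)
   (b b' : 'rV[R]_n -> 'M[R]_n) : open U -> smooth_on U a -> smooth_on U b ->
  smooth_on U b' ->
  smooth_on [set y : 'rV[R]_n * fibre R n | U y.1]
    (fun y => (a y.1, (y.2.1 *m b y.1, b' y.1 *m y.2.2))).
Proof.
move=> oU sa sb sb'; have oU' := open_fst_preimage oU.
apply: smooth_on_pair => //; first exact: smooth_on_fst_comp.
apply: smooth_on_pair => //; apply: smooth_on_mulmx => //.
- exact: (smooth_on_linear oU' (fst \o snd)).
- exact: smooth_on_fst_comp.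
- exact: smooth_on_fst_comp.
- exact: (smooth_on_linear oU' (snd \o snd)).
Qed.

(** In charts the action reads [(x, v, xi) |-> (phi x, v J_phi(x), J_psi(phi x) xi)], where [psi] is
    the expression of the inverse [g]; the changes to and from [chart_at] telescope. Writing the
    inverse matrix as a Jacobian of [psi] makes every entry visibly smooth. *)
Lemma diff_action_smooth f g : smoothM f -> smoothM g -> cancel f g -> cancel g f ->
  smooth_map (bundle_atlas M) (bundle_atlas M) (diff_action M f).
Proof.
move=> fs gs fK gK _ _ [c Ac <-] [c' Ac' <-].
rewrite -/(chart_dom _ _ _) (@bundle_chart_dom f) //.
have [/= oU sf] := fs _ _ Ac Ac'; have [/= oU' sg] := gs _ _ Ac' Ac.
rewrite -/(chart_dom c c' f) in oU sf; rewrite -/(chart_dom c' c g) in oU' sg.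
split; first exact: open_fst_preimage.
pose phi := to c' \o f \o from c; pose psi := to c \o g \o from c'.
have oV := open_fst_preimage oU.
apply: (smooth_on_ext oV (f := fun y => (phi y.1, (y.2.1 *m jacobian phi y.1,
   jacobian psi (phi y.1) *m y.2.2)))).
  move=> [x v]; rewrite inE => /(chart_domP (atlas_smooth M) Ac)[p [/= <-{x} _ cp c'p]].
  rewrite -[RHS]/(to (bundle_chart c') (diff_action M f (from (bundle_chart c) (to c p, v)))).
  have [Ap pp] := chart_atP p; have [Afp pfp] := chart_atP (f p).
  rewrite (bundle_chart_from v Ac cp) bundle_chart_to /=.
  rewrite !tangentE; have [_ ->] := dm_invmx fs gs fK gK Ap Afp pp pfp.
  have E0 : phi (to c p) = to c' (f p) by rewrite /phi /= (atlasK Ac cp).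
  rewrite E0 -[jacobian phi (to c p)]/(dm f c c' p) -[jacobian psi _]/(dm g c' c (f p)).
  apply: pair3_eq; first by [].
  - rewrite -!mulmxA (mulmxA (dm id _ _ _)) (dm_transl fs Ac Ap Afp cp pp pfp).
    by rewrite (dm_transr fs Ac Afp Ac' cp pfp c'p).
  - have gfp : source (chart_at p) (g (f p)) by rewrite fK.
    have gfc : source c (g (f p)) by rewrite fK.
    have E1 := dm_transl gs Ac' Afp Ap c'p pfp gfp.
    have E2 := dm_transr gs Ac' Ap Ac c'p gfp gfc.
    by rewrite -E2 -E1 -!mulmxA fK.
apply: (smooth_on_fibre_map (a := phi) (b := jacobian phi)
  (b' := fun x => jacobian psi (phi x))) => //.
  exact: smooth_on_jacobian.
apply: (smooth_on_comp oU oU') => //.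
  move=> x /(chart_domP (atlas_smooth M) Ac)[p [<- _ cp c'p]].
  by rewrite /phi /= atlasK //; exists (f p) => //; rewrite /= fK.
exact: smooth_on_jacobian.
Qed.

Lemma diff_action_id : diff_action M id = id.
Proof.
apply/funext => -[p [v xi]]; have [Ap pp] := chart_atP p.
by rewrite /diff_action tangentE /= dm_id // invmx1 mulmx1 mul1mx.
Qed.

Lemma diff_action_comp f g : diffeomorphism (atlas M) (atlas M) f ->
  diffeomorphism (atlas M) (atlas M) g ->
  diff_action M (f \o g) = diff_action M f \o diff_action M g.
Proof.
move=> [fs [f' [fs' fK f'K]]] [gs [g' [gs' gK g'K]]].
apply/funext => -[p [v xi]]; rewrite /diff_action /= !tangentE.
have [Ap pp] := chart_atP p; have [Agp pgp] := chart_atP (g p).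
have [Afgp pfgp] := chart_atP (f (g p)).
rewrite (dm_comp gs fs Ap Agp Afgp) // mulmxA.
have [u1 _] := dm_invmx gs gs' gK g'K Ap Agp pp pgp.
have [u2 _] := dm_invmx fs fs' fK f'K Agp Afgp pgp pfgp.
by rewrite (invmx_mul u1 u2) mulmxA.
Qed.

Lemma bundle_atlas_smooth : smooth_atlas (bundle_atlas M).
Proof.
split.
- move=> [p v]; have [Ap pp] := chart_atP p.
  by exists (bundle_chart (chart_at p)) => //; exists (chart_at p).
- by move=> _ [p v] [c Ac <-] /= cp; exact: bundle_chartK.
(* The transition maps of the bundle are the chart expressions of the action of [id], so their
   smoothness is a special case of [diff_action_smooth]. *)
- by rewrite -diff_action_id; apply: (@diff_action_smooth id id) => //; exact: smooth_id.
Qed.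

End BundleMaps.

(** * The Courant bracket in coordinates *)

Section Pairing.
Variables (R : realType) (n : nat).
Implicit Types (v w : 'rV[R]_n) (xi eta : 'cV[R]_n) (a b : fibre R n) (B : 'M[R]_n).

Lemma pairingDl v w xi : pairing (v + w) xi = pairing v xi + pairing w xi.
Proof. by rewrite /pairing mulmxDl mxE. Qed.
Lemma pairingDr v xi eta : pairing v (xi + eta) = pairing v xi + pairing v eta.
Proof. by rewrite /pairing mulmxDr mxE. Qed.
Lemma pairingNr v xi : pairing v (- xi) = - pairing v xi.
Proof. by rewrite /pairing mulmxN mxE. Qed.
Lemma pairingZl k v xi : pairing (k *: v) xi = k * pairing v xi.
Proof. by rewrite /pairing -scalemxAl mxE. Qed.
Lemma pairingZr k v xi : pairing v (k *: xi) = k * pairing v xi.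
Proof. by rewrite /pairing -scalemxAr mxE. Qed.
Lemma pairing0l xi : pairing (0 : 'rV[R]_n) xi = 0.
Proof. by rewrite /pairing mul0mx mxE. Qed.
Lemma pairing0r v : pairing v (0 : 'cV[R]_n) = 0.
Proof. by rewrite /pairing mulmx0 mxE. Qed.
Lemma pairingM v B xi : pairing (v *m B) xi = pairing v (B *m xi).
Proof. by rewrite /pairing mulmxA. Qed.

Lemma pairing_ext xi eta : (forall w, pairing w xi = pairing w eta) -> xi = eta.
Proof.
move=> E; apply/colP => i; have := E (delta_mx 0 i).
by rewrite /pairing -!rowE !mxE.
Qed.

Lemma pairing_contract w v B : pairing w (contract v B) = (v *m B *m w^T) 0 0.
Proof.
by rewrite /pairing /contract -{1}[w]trmxK -trmx_mul mxE.
Qed.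

Lemma contract_skew v w B : B^T = - B ->
  pairing v (contract w B) = - pairing w (contract v B).
Proof.
move=> sB; rewrite !pairing_contract.
have -> : (w *m B *m v^T) 0 0 = (w *m B *m v^T)^T 0 0 by rewrite [RHS]mxE.
by rewrite !trmx_mul trmxK sB mulNmx mulmxN mulmxA [LHS]mxE.
Qed.

Lemma contractDl v w B : contract (v + w) B = contract v B + contract w B.
Proof. by rewrite /contract mulmxDl linearD. Qed.
Lemma contractZl k v B : contract (k *: v) B = k *: contract v B.
Proof. by rewrite /contract -scalemxAl linearZ. Qed.
Lemma contractNl v B : contract (- v) B = - contract v B.
Proof. by rewrite /contract mulNmx linearN. Qed.
Lemma contractDr v B B' : contract v (B + B') = contract v B + contract v B'.
Proof. by rewrite /contract mulmxDr linearD. Qed.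

End Pairing.

Section DifferentialOperations.
Variables (R : realType) (n : nat).

Lemma is_diff_fst (V W1 W2 : normedModType R) (a da : V -> W1 * W2) (x : V) :
  is_diff x a da -> is_diff x (fst \o a) (fst \o da).
Proof.
move=> ad; have fc : continuous (fst : W1 * W2 -> W1) by move=> y; exact: cvg_fst.
have fd : is_diff (a x) (fst : W1 * W2 -> W1) fst.
  by apply: DiffDef; [exact: linear_differentiable|rewrite diff_lin].
exact: (is_diff_comp ad fd).
Qed.

Lemma is_diff_snd (V W1 W2 : normedModType R) (a da : V -> W1 * W2) (x : V) :
  is_diff x a da -> is_diff x (snd \o a) (snd \o da).
Proof.
move=> ad; have fc : continuous (snd : W1 * W2 -> W2) by move=> y; exact: cvg_snd.
have fd : is_diff (a x) (snd : W1 * W2 -> W2) snd.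
  by apply: DiffDef; [exact: linear_differentiable|rewrite diff_lin].
exact: (is_diff_comp ad fd).
Qed.

Lemma is_diff_trmx (V : normedModType R) m p (f df : V -> 'M[R]_(m, p)) (x : V) :
  is_diff x f df -> is_diff x (trmx \o f) (trmx \o df).
Proof.
move=> fd; apply: is_diff_comp fd _; exact: is_diff_linear.
Qed.

Lemma is_diff_mulmx (V : normedModType R) m p q (f df : V -> 'M[R]_(m, p))
    (g dg : V -> 'M[R]_(p, q)) (x : V) :
  is_diff x f df -> is_diff x g dg ->
  is_diff x (fun y => f y *m g y) (fun v => f x *m dg v + df v *m g x).
Proof.
move=> fd gd; exact: (@is_diff_bilin _ _ _ _ _ _ _ (@mulmx R m p q) _ _ _ _ _ fd gd).
Qed.

Lemma is_diff_pairing (V : normedModType R) (f df : V -> 'rV[R]_n)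
    (g dg : V -> 'cV[R]_n) (x : V) :
  is_diff x f df -> is_diff x g dg ->
  is_diff x (fun y => pairing (f y) (g y))
    (fun v => pairing (f x) (dg v) + pairing (df v) (g x)).
Proof.
move=> fd gd; have h := is_diff_mulmx fd gd.
pose l (w : 'M[R]_1) : R := w 0 0.
have ll : linear (l : _ -> R^o) by move=> k w w'; rewrite /l !mxE.
pose L : {linear 'M[R]_1 -> R^o} := HB.pack (l : _ -> R^o) (GRing.isLinear.Build _ _ _ _ _ ll).
have h' : is_diff x (L \o (fun y => f y *m g y)) (L \o (fun v => f x *m dg v + df v *m g x)).
  by apply: is_diff_comp h _; exact: is_diff_linear.
rewrite (_ : (fun v => pairing _ _ + _) = L \o (fun v => f x *m dg v + df v *m g x)).
  exact: h'.
by apply/funext => v; rewrite /= /l mxE.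
Qed.

Lemma is_diff_derive (V W : normedModType R) (f df : V -> W) (x v : V) :
  is_diff x f df -> 'D_v f x = df v.
Proof. by move=> [fd <-]; rewrite deriveE. Qed.

Lemma is_diff_uniq (V W : normedModType R) (f d1 d2 : V -> W) (x v : V) :
  is_diff x f d1 -> is_diff x f d2 -> d1 v = d2 v.
Proof. by move=> [_ <-] [_ <-]. Qed.

Lemma pairing_jacobian (f df : 'rV[R]_n -> 'rV[R]_n) (x w : 'rV[R]_n) (xi : 'cV[R]_n) :
  is_diff x f df -> pairing w (jacobian f x *m xi) = pairing (df w) xi.
Proof. by move=> fd; rewrite -(mul_jacobian w fd) pairingM. Qed.

End DifferentialOperations.

(** * The bracket of 1-jets, under diffeomorphisms and under 2-forms *)

Section LocalCourant.
Variables (R : realType) (n : nat).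
Implicit Types (x v w : 'rV[R]_n) (a b : 'rV[R]_n -> fibre R n).

Definition local_courant a b x : fibre R n :=
  ('D_(a x).1 (fst \o b) x - 'D_(b x).1 (fst \o a) x,
   'D_(a x).1 (snd \o b) x + jacobian (fst \o a) x *m (b x).2
   - ('D_(b x).1 (snd \o a) x + jacobian (fst \o b) x *m (a x).2)
   - 2^-1 *: \col_i 'D_(delta_mx 0 i)
       (fun y => pairing (a y).1 (b y).2 - pairing (b y).1 (a y).2) x).

(** The derivatives in direction [w] come from the Jacobian terms of the two Lie derivatives and
    from half the differential of the pairings. Together they form the inner products
    [<da w, b> - <a, db w>], so the bracket is expressed by values and differentials alone. *)
Lemma local_courantE a b x da db : is_diff x a da -> is_diff x b db ->
  (local_courant a b x).1 = (db (a x).1).1 - (da (b x).1).1 /\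
  forall w, pairing w (local_courant a b x).2 =
    pairing w (db (a x).1).2 - pairing w (da (b x).1).2
    + inner (da w) (b x) - inner (a x) (db w).
Proof.
move=> ad bd; have a1 := is_diff_fst ad; have a2 := is_diff_snd ad.
have b1 := is_diff_fst bd; have b2 := is_diff_snd bd.
split=> [|w]; first by rewrite /= (is_diff_derive _ b1) (is_diff_derive _ a1).
rewrite /local_courant /= (is_diff_derive _ b2) (is_diff_derive _ a2).
have hd := is_diffB (is_diff_pairing a1 b2) (is_diff_pairing b1 a2).
rewrite !(pairingDr, pairingNr, pairingZr).
rewrite (pairing_jacobian w _ a1) (pairing_jacobian w _ b1).
have -> : pairing w (\col_i 'D_(delta_mx 0 i)
       (fun y => pairing (a y).1 (b y).2 - pairing (b y).1 (a y).2) x) =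
   pairing (a x).1 (db w).2 + pairing (da w).1 (b x).2
     - (pairing (b x).1 (da w).2 + pairing (db w).1 (a x).2).
  transitivity ('d (fun y => pairing (a y).1 (b y).2 - pairing (b y).1 (a y).2) x w).
    rewrite /pairing mxE {2}(matrix_sum_delta w) big_ord1 linear_sum /=.
    apply: eq_bigr => i _; rewrite linearZ !mxE; congr (_ * _).
    by have [hd1 _] := hd; rewrite deriveE.
  by have [_ ->] := hd.
rewrite /inner; lra.
Qed.

Lemma fibre_ext (a b : fibre R n) : a.1 = b.1 ->
  (forall w, pairing w a.2 = pairing w b.2) -> a = b.
Proof. by case: a b => [v xi] [v' xi'] /= -> /pairing_ext ->. Qed.

(** The algebra of naturality at one point: [J] is the Jacobian of the coordinate map, [D v] its
    derivative along [v], and primes mark the data at the image point. Covectors are related by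
    pullback, [a.2 = J *m a'.2], which keeps inverse matrices out of the computation. *)
Lemma jet_natural (J : 'M[R]_n) (D : 'rV[R]_n -> 'M[R]_n) (a b a' b' C C' : fibre R n)
    (da db da' db' : 'rV[R]_n -> fibre R n) :
  (forall u v, u *m D v = v *m D u) ->
  a'.1 = a.1 *m J /\ a.2 = J *m a'.2 ->
  b'.1 = b.1 *m J /\ b.2 = J *m b'.2 ->
  (forall v, (da' (v *m J)).1 = (da v).1 *m J + a.1 *m D v /\
             (da v).2 = D v *m a'.2 + J *m (da' (v *m J)).2) ->
  (forall v, (db' (v *m J)).1 = (db v).1 *m J + b.1 *m D v /\
             (db v).2 = D v *m b'.2 + J *m (db' (v *m J)).2) ->
  C.1 = (db a.1).1 - (da b.1).1 ->
  (forall w, pairing w C.2 = pairing w (db a.1).2 - pairing w (da b.1).2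
    + inner (da w) b - inner a (db w)) ->
  C'.1 = (db' a'.1).1 - (da' b'.1).1 ->
  (forall w, pairing w C'.2 = pairing w (db' a'.1).2 - pairing w (da' b'.1).2
    + inner (da' w) b' - inner a' (db' w)) ->
  C'.1 = C.1 *m J /\ J *m C'.2 = C.2.
Proof.
move=> Dsym [a1 a2] [b1 b2] ka kb C1 C2 C1' C2'; split.
  rewrite C1 C1' a1 b1 (ka _).1 (kb _).1 mulmxBl (Dsym a.1).
  by rewrite opprD addrACA subrr addr0.
apply: pairing_ext => w; rewrite -pairingM C2 C2' a1 b1 !pairingM.
have Pa u v : pairing u (J *m (da' (v *m J)).2) =
   pairing u (da v).2 - pairing u (D v *m a'.2).
  by rewrite (ka v).2 pairingDr addrC addrA addNr add0r.
have Pb u v : pairing u (J *m (db' (v *m J)).2) =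
   pairing u (db v).2 - pairing u (D v *m b'.2).
  by rewrite (kb v).2 pairingDr addrC addrA addNr add0r.
rewrite Pb Pa /inner a1 b1 !pairingM.
rewrite Pb Pa (ka w).1 (kb w).1 !pairingDl !pairingM -a2 -b2.
rewrite -!(pairingM _ (D _)) (Dsym w a.1) (Dsym w b.1).
lra.
Qed.

(* The terms with second derivatives of [phi] cancel because these are
   symmetric. *)
Lemma local_courant_natural (U : set 'rV[R]_n) (phi : 'rV[R]_n -> 'rV[R]_n)
    a b a' b' x da db da' db' :
  open U -> smooth_on U phi -> U x ->
  is_diff x a da -> is_diff x b db ->
  is_diff (phi x) a' da' -> is_diff (phi x) b' db' ->
  (forall y, U y -> (a' (phi y)).1 = (a y).1 *m jacobian phi y
                 /\ (a y).2 = jacobian phi y *m (a' (phi y)).2) ->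
  (forall y, U y -> (b' (phi y)).1 = (b y).1 *m jacobian phi y
                 /\ (b y).2 = jacobian phi y *m (b' (phi y)).2) ->
  (local_courant a' b' (phi x)).1 = (local_courant a b x).1 *m jacobian phi x /\
  jacobian phi x *m (local_courant a' b' (phi x)).2 = (local_courant a b x).2.
Proof.
move=> oU sphi Ux ad bd ad' bd' aa' bb'.
have phid := smooth_on_is_diff sphi Ux.
set J := jacobian phi in aa' bb' *.
(* [u *m D v] is the second derivative of [phi] in the directions [u] and [v], hence symmetric. *)
have [D [Jd Jsym]] : exists D : 'rV[R]_n -> 'M[R]_n,
    is_diff x J D /\ forall u v, u *m D v = v *m D u.
  exists ('d J x); have Jd : is_diff x J ('d J x).
    by apply: smooth_on_is_diff Ux; exact: smooth_on_jacobian.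
  split=> // u v; have d1 (w z : 'rV[R]_n) : w *m 'd J x z = 'd (fun y => 'd phi y w) x z.
    have h := is_diff_mulmx (is_diff_cst w x) Jd.
    have : is_diff x (fun y => 'd phi y w) (fun v => w *m 'd J x v + 0 *m J x).
      apply: near_eq_is_diff h; apply: filterS (open_near oU Ux) => y Uy.
      exact: mul_jacobian w (smooth_on_is_diff sphi Uy).
    by move=> [_ E]; rewrite E mul0mx addr0.
  by rewrite !d1; exact: smooth_on_diff_sym Ux.
have JE v : 'd phi x v = v *m J x by rewrite (mul_jacobian _ phid).
have key (c c' dc dc' : 'rV[R]_n -> fibre R n) : is_diff x c dc ->
   is_diff (phi x) c' dc' ->
  (forall y, U y -> (c' (phi y)).1 = (c y).1 *m J y /\ (c y).2 = J y *m (c' (phi y)).2) ->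
  forall v, (dc' (v *m J x)).1 = (dc v).1 *m J x + (c x).1 *m D v /\
            (dc v).2 = D v *m (c' (phi x)).2 + J x *m (dc' (v *m J x)).2.
  move=> cd cd' cc' v.
  have cphi := is_diff_comp phid cd'.
  have h1 : is_diff x (fst \o (c' \o phi)) (fun v => (c x).1 *m D v + (dc v).1 *m J x).
    apply: near_eq_is_diff (is_diff_mulmx (is_diff_fst cd) Jd).
    by apply: filterS (open_near oU Ux) => y Uy; have [/= ->] := cc' y Uy.
  have h2 : is_diff x (snd \o c)
      (fun v => J x *m (dc' ('d phi x v)).2 + D v *m (c' (phi x)).2).
    apply: near_eq_is_diff (is_diff_mulmx Jd (is_diff_snd cphi)).
    by apply: filterS (open_near oU Ux) => y Uy; have [_ /= ->] := cc' y Uy.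
  split.
    rewrite -JE addrC; exact: (is_diff_uniq v (is_diff_fst cphi) h1).
  rewrite -JE addrC; exact: (is_diff_uniq v (is_diff_snd cd) h2).
have ka := key _ _ _ _ ad ad' aa'; have kb := key _ _ _ _ bd bd' bb'.
have [C1 C2] := local_courantE ad bd; have [C1' C2'] := local_courantE ad' bd'.
exact: (jet_natural Jsym (aa' x Ux) (bb' x Ux) ka kb C1 C2 C1' C2').
Qed.

(** The terms with [B] itself recombine, by skewness, into the contraction of the bracket of the
    vector parts. Those with [dB] form the cyclic sum that is the exterior derivative of [B] on the
    vector parts of [a], [b] and on [w]. *)
Lemma local_courant_B_field (U : set 'rV[R]_n) (B : 'rV[R]_n -> 'M[R]_n)
    dB a b a' b' x da db :
  open U -> U x -> is_diff x B dB -> (forall y, U y -> (B y)^T = - B y) ->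
  is_diff x a da -> is_diff x b db ->
  (forall y, U y -> a' y = ((a y).1, (a y).2 + contract (a y).1 (B y))) ->
  (forall y, U y -> b' y = ((b y).1, (b y).2 + contract (b y).1 (B y))) ->
  let C := local_courant a b x in
  (local_courant a' b' x).1 = C.1 /\
  forall w, pairing w (local_courant a' b' x).2 =
    pairing w (C.2 + contract C.1 (B x)) +
    (pairing w (contract (b x).1 (dB (a x).1)) +
     pairing (a x).1 (contract w (dB (b x).1)) +
     pairing (b x).1 (contract (a x).1 (dB w))).
Proof.
move=> oU Ux Bd sB ad bd aa' bb' C.
(* Skewness of [B] on a neighbourhood is differentiated, since the terms in [dB] must be reordered
   as well. *)
have sdB v : (dB v)^T = - dB v.
  have h1 : is_diff x (trmx \o B) (trmx \o dB).
    exact: is_diff_trmx.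
  have h2 : is_diff x (trmx \o B) (- dB).
    apply: near_eq_is_diff (is_diffN Bd).
    by apply: filterS (open_near oU Ux) => y Uy; rewrite /= sB.
  exact: (is_diff_uniq v h1 h2).
have key (c c' dc : 'rV[R]_n -> fibre R n) : is_diff x c dc ->
  (forall y, U y -> c' y = ((c y).1, (c y).2 + contract (c y).1 (B y))) ->
  is_diff x c' (fun v => ((dc v).1,
    (dc v).2 + (contract (c x).1 (dB v) + contract (dc v).1 (B x)))).
  move=> cd cc'.
  have h := is_diff_mulmx (is_diff_fst cd) Bd.
  have h' := is_diff_trmx h.
  have h2 := is_diff_pair (is_diff_fst cd) (is_diffD (is_diff_snd cd) h').
  pose dc2 v : fibre R n := ((dc v).1, (dc v).2 + ((c x).1 *m dB v + (dc v).1 *m B x)^T).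
  have h3 : is_diff x c' dc2.
    apply: near_eq_is_diff h2.
    by apply: filterS (open_near oU Ux) => y Uy; rewrite cc'.
  rewrite (_ : (fun v => _) = dc2); first exact: h3.
  by apply/funext => v; rewrite /dc2 /contract -linearD.
have [C1 C2] := local_courantE ad bd.
have [C1' C2'] := local_courantE (key _ _ _ ad aa') (key _ _ _ bd bb').
have a'x := aa' x Ux; have b'x := bb' x Ux.
split; first by rewrite C1' /C C1 a'x b'x.
move=> w; rewrite C2' pairingDr /C C2 C1 a'x b'x /inner /=.
rewrite !(pairingDr, contractDl, contractNl, pairingNr).
have skB := contract_skew _ _ (sB x Ux).
have skdB u v z := contract_skew u v (sdB z).
rewrite (skB (a x).1 (db w).1) (skB (da w).1 (b x).1).
rewrite (skdB (a x).1 (b x).1 w) (skdB (a x).1 w (b x).1).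
lra.
Qed.

End LocalCourant.

(** * Smooth sections *)

Lemma mulmx_square_row (R : pzRingType) n (v : 'rV[R]_n) (F I I' F' : 'M[R]_n) :
  F *m I = I' *m F' -> v *m F *m I = v *m I' *m F'.
Proof. by move=> E; rewrite -mulmxA E mulmxA. Qed.

Lemma mulmx_square_col (R : pzRingType) n (v : 'cV[R]_n) (F I I' F' : 'M[R]_n) :
  F *m I = I' *m F' -> F *m (I *m v) = I' *m (F' *m v).
Proof. by move=> E; rewrite mulmxA E mulmxA. Qed.

Section Sections.
Variables (R : realType) (n : nat) (M : manifold R n).
Implicit Types (c : chart M 'rV[R]_n) (p : M) (f g : M -> M) (A : M -> fibre R n).

Local Notation smoothM := (smooth_map (atlas M) (atlas M)).
Local Notation smoothE := (smooth_map (bundle_atlas M) (bundle_atlas M)).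

(** The pair [A q] consists of components in the chart [chart_at q], which need not vary
    continuously with [q]. Only this expression in a fixed chart can be differentiated. *)
Definition loc c A (x : 'rV[R]_n) : fibre R n :=
  (vec_in c (fun q => (A q).1) x, cov_in c (fun q => (A q).2) x).

Lemma locE c A p : atlas M c -> source c p ->
  loc c A (to c p) = ((A p).1 *m dm id (chart_at p) c p, dm id c (chart_at p) p *m (A p).2).
Proof.
move=> Ac cp; have [Ap pp] := chart_atP p.
by rewrite /loc /vec_in /cov_in (atlasK Ac cp) /pos vec_changeE (cov_changeE _ _ Ap pp).
Qed.

Lemma loc_pos A p : loc (chart_at p) A (pos p) = A p.
Proof.
have [Ap pp] := chart_atP p.
by rewrite /pos (locE _ Ap pp) (dm_id Ap pp) mulmx1 mul1mx; case: (A p).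
Qed.

Lemma open_target c : atlas M c -> open (target c).
Proof. by move=> /atlas_chart[]. Qed.

Lemma target_pos p : target (chart_at p) (pos p).
Proof. by have [Ap pp] := chart_atP p; exists p. Qed.

Lemma smooth_section_loc c A : smooth_section A -> atlas M c ->
  smooth_on (target c) (loc c A).
Proof.
move=> sA Ac; have Bc : bundle_atlas M (bundle_chart c) by exists c.
have [oW s] := sA _ _ Ac Bc.
have s' : smooth_on (target c) (to (bundle_chart c) \o (fun p => (p, A p) : total_space M) \o from c).
  by apply: smooth_on_subset s => _ [p cp <-]; exists p.
exact: (smooth_on_linear_comp (open_target Ac) snd s').
Qed.

Lemma smooth_section_is_diff A p : smooth_section A ->
  is_diff (pos p) (loc (chart_at p) A) ('d (loc (chart_at p) A) (pos p)).
Proof.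
have [Ap pp] := chart_atP p.
move=> sA; apply: (smooth_on_is_diff (smooth_section_loc sA Ap)); exact: target_pos.
Qed.

Lemma smooth_section_local A :
  (forall p, exists c U, [/\ atlas M c, source c p, open U
     & [/\ U (to c p), U `<=` target c & smooth_on U (loc c A)]]) ->
  smooth_section A.
Proof.
move=> H; apply: smooth_map_local => [||p]; [exact: atlas_smooth|exact: bundle_atlas_smooth|].
have [c [U [Ac cp oU [Ucp Uc sU]]]] := H p.
exists c, (bundle_chart c), U; split=> //; first by exists c.
split=> //; first by move=> x /Uc[q cq <-]; exists q.
apply: (smooth_on_ext oU (f := fun x => (x, loc c A x))).
  move=> x; rewrite inE => /Uc[q cq <-].
  by rewrite /= (atlasK Ac cq) /loc /vec_in /cov_in (atlasK Ac cq).
apply: smooth_on_pair => //; exact: (smooth_on_linear oU idfun).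
Qed.

Lemma smooth_section_act f g (F : total_space M -> total_space M) A :
  smoothE F -> smoothM g -> cancel g f -> (forall e, (F e).1 = f e.1) ->
  smooth_section A -> smooth_section (act g F A).
Proof.
move=> sF sg gK Ff sA.
rewrite /smooth_section (_ : (fun p => _) = F \o (fun p => (p, A p) : total_space M) \o g).
  have sM := atlas_smooth M; have sB := bundle_atlas_smooth M.
  apply: (smooth_map_comp sM sM sB sg); exact: (smooth_map_comp sM sB sB sA).
apply/funext => p /=; rewrite [RHS]surjective_pairing Ff /= gK.
by rewrite /act.
Qed.

Lemma courant_loc A A' p :
  courant A A' p = local_courant (loc (chart_at p) A) (loc (chart_at p) A') (pos p).
Proof.
have [Ap pp] := chart_atP p.
rewrite /courant /local_courant !loc_pos; apply: congr2; first by [].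
apply: congr2; first by [].
apply: congr1; apply: congr1; apply/matrixP => i j; rewrite !mxE.
apply: near_eq_derive.
apply: filterS (open_near (open_target Ap) (target_pos p)) => _ [q cq <-].
have [Aq qq] := chart_atP q.
(* The function under the differential in [courant] pairs components in the moving chart
   [chart_at q]. The pairing of a vector with a covector does not depend on the chart, so near [p]
   it equals the pairing of the expressions in [chart_at p]. *)
have K (v : 'rV[R]_n) (xi : 'cV[R]_n) : pairing (v *m dm id (chart_at q) (chart_at p) q)
    (dm id (chart_at p) (chart_at q) q *m xi) = pairing v xi.
  by rewrite -pairingM -mulmxA (dm_transK Aq Ap qq cq) mulmx1.
by rewrite !(locE _ Ap cq) /= (atlasK Ap cq) !K.
Qed.

Lemma loc_diff_action f g A c c' p : smoothM f -> smoothM g -> cancel f g -> cancel g f ->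
  atlas M c -> atlas M c' -> source c p -> source c' (f p) ->
  loc c' (act g (diff_action M f) A) (to c' (f p)) =
  ((loc c A (to c p)).1 *m dm f c c' p, dm g c' c (f p) *m (loc c A (to c p)).2).
Proof.
move=> fs gs fK gK Ac Ac' cp c'p.
have [Ap pp] := chart_atP p; have [Afp pfp] := chart_atP (f p).
rewrite (locE _ Ac' c'p) (locE _ Ac cp) /act fK /= !tangentE.
have [_ ->] := dm_invmx fs gs fK gK Ap Afp pp pfp.
have gfp : source (chart_at p) (g (f p)) by rewrite fK.
have gfc : source c (g (f p)) by rewrite fK.
have E1 := dm_transl gs Ac' Afp Ap c'p pfp gfp.
have E2 := dm_transr gs Ac' Ac Ap c'p gfc gfp.
apply: congr2.
  apply: mulmx_square_row; apply: (etrans (dm_transr fs Ap Afp Ac' pp pfp c'p)).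
  exact: esym (dm_transl fs Ap Ac Ac' pp cp c'p).
by apply: mulmx_square_col; apply: (etrans E1); rewrite -E2 fK.
Qed.

Lemma diff_action_courant f g : smoothM f -> smoothM g -> cancel f g -> cancel g f ->
  forall A A', smooth_section A -> smooth_section A' ->
  act g (diff_action M f) (courant A A') =
  courant (act g (diff_action M f) A) (act g (diff_action M f) A').
Proof.
move=> fs gs fK gK A A' sA sA'.
set F := diff_action M f.
have sF : smoothE F by exact: (diff_action_smooth fs gs).
have Ff e : (F e).1 = f e.1 by [].
have sB := smooth_section_act sF gs gK Ff sA.
have sB' := smooth_section_act sF gs gK Ff sA'.
apply/funext => q; rewrite -(gK q); move: (g q) => p {q}.
have [Ap pp] := chart_atP p; have [Afp pfp] := chart_atP (f p).
have [/= oU sphi] := fs _ _ Ap Afp.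
rewrite -/(chart_dom (chart_at p) (chart_at (f p)) f) in oU sphi.
set phi := to _ \o f \o _ in sphi.
have phiE r : source (chart_at p) r -> phi (to (chart_at p) r) = to (chart_at (f p)) (f r).
  by move=> pr; rewrite /phi /= (atlasK Ap pr).
have key D y : chart_dom (chart_at p) (chart_at (f p)) f y ->
  (loc (chart_at (f p)) (act g F D) (phi y)).1 =
      (loc (chart_at p) D y).1 *m jacobian phi y /\
  (loc (chart_at p) D y).2 =
    jacobian phi y *m (loc (chart_at (f p)) (act g F D) (phi y)).2.
  move=> [r [pr fpr] <-]; rewrite (phiE _ pr) (loc_diff_action D fs gs fK gK Ap Afp pr fpr) /=.
  split; first by [].
  rewrite mulmxA -[jacobian phi _]/(dm f (chart_at p) (chart_at (f p)) r).
  by rewrite (dm_inv fs gs fK Ap Afp pr fpr) mul1mx.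
have Up : chart_dom (chart_at p) (chart_at (f p)) f (pos p) by exists p.
have dB := smooth_section_is_diff (f p) sB.
have dB' := smooth_section_is_diff (f p) sB'.
rewrite /pos -(phiE _ pp) in dB dB'.
have := local_courant_natural oU sphi Up (smooth_section_is_diff p sA)
   (smooth_section_is_diff p sA') dB dB' (key A) (key A').
rewrite (phiE _ pp) -!courant_loc => -[C1 C2].
have [u _] := dm_invmx fs gs fK gK Ap Afp pp pfp.
rewrite -[jacobian phi (pos p)]/(dm f (chart_at p) (chart_at (f p)) p) in C1 C2.
have -> D : act g F D (f p) = ((D p).1 *m dm f (chart_at p) (chart_at (f p)) p,
    invmx (dm f (chart_at p) (chart_at (f p)) p) *m (D p).2).
  by rewrite /act fK.
move: (courant A A' p) (courant (act g F A) _ (f p)) C1 C2 => C [v xi] /= -> <-.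
by rewrite (mulKmx u).
Qed.

End Sections.

(** * B-field transformations *)

Section BFields.
Variables (R : realType) (n : nat) (M : manifold R n).
Implicit Types (c : chart M 'rV[R]_n) (p : M) (A : M -> fibre R n) (B : M -> 'M[R]_n).

Local Notation smoothE := (smooth_map (bundle_atlas M) (bundle_atlas M)).

Lemma form_inE c B p : atlas M c -> source c p ->
  form_in c B (to c p) = dm id c (chart_at p) p *m B p *m (dm id c (chart_at p) p)^T.
Proof. by move=> Ac cp; rewrite /form_in (atlasK Ac cp). Qed.

Lemma form_in_pos B p : form_in (chart_at p) B (pos p) = B p.
Proof.
have [Ap pp] := chart_atP p.
by rewrite /pos (form_inE _ Ap pp) (dm_id Ap pp) mul1mx trmx1 mulmx1.
Qed.

(** A form changes charts by [J b J^T], so its contraction with a vector changes as a covector. This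
    is why [B_field] has the same formula in every chart. *)
Lemma contract_form_in c B p (v : 'rV[R]_n) : atlas M c -> source c p ->
  contract (v *m dm id (chart_at p) c p) (form_in c B (to c p)) =
  dm id c (chart_at p) p *m contract v (B p).
Proof.
move=> Ac cp; have [Ap pp] := chart_atP p.
rewrite (form_inE _ Ac cp) /contract.
have := dm_transK Ap Ac pp cp.
move: (dm id (chart_at p) c p) (dm id c (chart_at p) p) (B p) => K J b KJ.
by rewrite !mulmxA -(mulmxA v) KJ mulmx1 trmx_mul trmxK.
Qed.

Lemma loc_B_field c B A x : atlas M c -> target c x ->
  loc c (act id (B_field M B) A) x =
  ((loc c A x).1, (loc c A x).2 + contract (loc c A x).1 (form_in c B x)).
Proof.
move=> Ac [p cp <-]; have [Ap pp] := chart_atP p.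
rewrite !(locE _ Ac cp) /act [X in _ = X]/= (contract_form_in _ _ Ac cp).
by rewrite -mulmxDr.
Qed.

Lemma form_in_skew c B x : (forall p, (B p)^T = - B p) ->
  (form_in c B x)^T = - form_in c B x.
Proof.
move=> sB; rewrite /form_in.
move: (jacobian _ _) => J.
by rewrite !trmx_mul trmxK sB mulNmx mulmxN mulmxA.
Qed.

Lemma B_fieldD B B' : B_field M B \o B_field M B' = B_field M (fun p => B p + B' p).
Proof.
apply/funext => -[p [v xi]]; rewrite /B_field /=.
by rewrite contractDr addrA addrAC.
Qed.

Lemma B_field0 : B_field M (fun=> 0) = id.
Proof.
by apply/funext => -[p [v xi]]; rewrite /B_field /= /contract mulmx0 trmx0 addr0.
Qed.

Lemma B_field_smooth B : two_form B -> smoothE (B_field M B).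
Proof.
move=> [_ sB]; have sE := bundle_atlas_smooth M.
apply: smooth_map_local => // -[p v].
have [Ap pp] := chart_atP p; set c := chart_at p in Ap pp *.
have oT := open_target Ap; have oU := open_fst_preimage oT.
exists (bundle_chart c), (bundle_chart c), [set y | target c y.1]; split=> //.
- by exists c.
- by exists c.
split; first by exists p.
  rewrite (@bundle_chart_dom _ _ _ id) // => -[x w] /= [q cq <-]; exists q => //.
apply: (smooth_on_ext oU (f := fun y => (y.1, (y.2.1, y.2.2 + (y.2.1 *m form_in c B y.1)^T)))).
  move=> [x w]; rewrite inE => -[q /= cq <-].
  rewrite -[RHS]/(to (bundle_chart c) (B_field M B (from (bundle_chart c) (to c q, w)))).
  have [Aq qq] := chart_atP q.
  rewrite (bundle_chart_from w Ap cq) bundle_chart_to /=.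
  have K1 := dm_transK Ap Aq cq qq.
  have := contract_form_in B (w.1 *m dm id c (chart_at q) q) Ap cq.
  move: K1; move: (dm id c (chart_at q) q) (dm id (chart_at q) c q) => K J.
  move: (form_in c B (to c q)) (B q) w.1 w.2 => F b u xi KJ E.
  have uE : u = u *m K *m J by rewrite -mulmxA KJ mulmx1.
  apply: pair3_eq => //.
  by rewrite mulmxDr -E -uE mulmxA KJ mul1mx.
apply: smooth_on_pair => //; first exact: (smooth_on_linear oU fst).
have s1 : smooth_on [set y : 'rV[R]_n * fibre R n | target c y.1] (fun y => y.2.1).
  exact: (smooth_on_linear oU (fst \o snd)).
apply: smooth_on_pair => //; apply: smooth_onD => //.
  exact: (smooth_on_linear oU (snd \o snd)).
apply: (smooth_on_linear_comp oU trmx); apply: smooth_on_mulmx => //.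
by apply: smooth_on_fst_comp => //; exact: sB.
Qed.

Lemma form_inD c B B' x :
  form_in c (fun p => B p + B' p) x = form_in c B x + form_in c B' x.
Proof. by rewrite /form_in mulmxDr mulmxDl. Qed.

Lemma form_inZ c B k x : form_in c (fun p => k *: B p) x = k *: form_in c B x.
Proof. by rewrite /form_in -scalemxAr -scalemxAl. Qed.

Lemma two_formD B B' : two_form B -> two_form B' -> two_form (fun p => B p + B' p).
Proof.
move=> [sB smB] [sB' smB']; split=> [p|c Ac].
  by rewrite linearD /= sB sB' opprD.
apply: (smooth_on_ext (open_target Ac) (f := fun x => form_in c B x + form_in c B' x)).
  by move=> x _; rewrite form_inD.
by apply: smooth_onD; [exact: open_target|exact: smB|exact: smB'].
Qed.

Lemma two_form_scale B (k : R) : two_form B -> two_form (fun p => k *: B p).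
Proof.
move=> [sB smB]; split=> [p|c Ac]; first by rewrite linearZ /= sB scalerN.
apply: (smooth_on_ext (open_target Ac) (f := fun x => k *: form_in c B x)).
  by move=> x _; rewrite form_inZ.
apply: smooth_on_scale; [exact: open_target|exact: smooth_on_cst|exact: smB].
Qed.

Lemma form_in_is_diff B p : two_form B ->
  is_diff (pos p) (form_in (chart_at p) B) ('d (form_in (chart_at p) B) (pos p)).
Proof.
have [Ap pp] := chart_atP p.
by move=> [_ sB]; apply: (smooth_on_is_diff (sB _ Ap)); exact: target_pos.
Qed.

Lemma exterior_derivativeE B dB p u v w : is_diff (pos p) (form_in (chart_at p) B) dB ->
  exterior_derivative B p u v w = pairing w (contract v (dB u)) +
     pairing u (contract w (dB v)) + pairing v (contract u (dB w)).
Proof.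
by move=> Bd; rewrite /exterior_derivative !(is_diff_derive _ Bd) !pairing_contract.
Qed.

Lemma exterior_derivativeD B B' p u v w : two_form B -> two_form B' ->
  exterior_derivative (fun p => B p + B' p) p u v w =
  exterior_derivative B p u v w + exterior_derivative B' p u v w.
Proof.
move=> tB tB'; have d1 := form_in_is_diff p tB; have d2 := form_in_is_diff p tB'.
have d3 := is_diffD d1 d2.
have E : form_in (chart_at p) B + form_in (chart_at p) B' =
    form_in (chart_at p) (fun p => B p + B' p).
  by apply/funext => x; exact: esym (form_inD _ _ _ _).
rewrite E in d3.
rewrite (exterior_derivativeE _ _ _ d1) (exterior_derivativeE _ _ _ d2).
rewrite (exterior_derivativeE _ _ _ d3) /= !contractDr !pairingDr.
have addr3 (a a1 b b1 c c1 : R) : a + a1 + (b + b1) + (c + c1) = a + b + c + (a1 + b1 + c1) by ring.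
exact: addr3.
Qed.

Lemma exterior_derivativeZ B k p u v w : two_form B ->
  exterior_derivative (fun p => k *: B p) p u v w = k * exterior_derivative B p u v w.
Proof.
move=> tB; have d1 := form_in_is_diff p tB.
have d3 := is_diffZ k d1.
have E : k *: (form_in (chart_at p) B : _ -> 'M[R]_n) = form_in (chart_at p) (fun p => k *: B p).
  by apply/funext => x; exact: esym (form_inZ _ _ _ _).
rewrite E in d3.
rewrite (exterior_derivativeE _ _ _ d1) (exterior_derivativeE _ _ _ d3) /=.
have cZ z b : contract z (k *: b) = k *: contract z b :> 'cV[R]_n.
  by rewrite /contract -scalemxAr linearZ.
by rewrite !cZ !pairingZr !mulrDr.
Qed.

(** Closedness is left out of the hypotheses because the identity is used in both directions: a
    closed [B] preserves the bracket, and preservation of the bracket forces the exterior derivative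
    of [B] to vanish. *)
Lemma courant_B_field B A A' p : two_form B -> smooth_section A -> smooth_section A' ->
  let C := courant A A' p in
  let C' := courant (act id (B_field M B) A) (act id (B_field M B) A') p in
  C'.1 = C.1 /\
  forall w, pairing w C'.2 =
    pairing w (C.2 + contract C.1 (B p)) + exterior_derivative B p (A p).1 (A' p).1 w.
Proof.
move=> tB sA sA' C C'; have [Ap pp] := chart_atP p.
have Bd := form_in_is_diff p tB.
have [C1 C2] := local_courant_B_field (open_target Ap) (target_pos p) Bd
  (fun y _ => form_in_skew (chart_at p) y tB.1)
  (smooth_section_is_diff p sA) (smooth_section_is_diff p sA')
  (fun y => @loc_B_field _ B A y Ap) (fun y => @loc_B_field _ B A' y Ap).
rewrite -!courant_loc form_in_pos !loc_pos in C1 C2.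
by split=> // w; rewrite C2 (exterior_derivativeE _ _ _ Bd).
Qed.

Lemma B_field_courant B A A' : closed_two_form M B ->
  smooth_section A -> smooth_section A' ->
  act id (B_field M B) (courant A A') =
  courant (act id (B_field M B) A) (act id (B_field M B) A').
Proof.
move=> [tB cB] sA sA'; apply/funext => p.
have [C1 C2] := courant_B_field p tB sA sA'.
apply: fibre_ext; first by rewrite C1.
by move=> w; rewrite C2 cB addr0.
Qed.

End BFields.

(** * Bump functions and sections with a prescribed 1-jet *)

Section FlatFunctions.
Variable R : realType.
Implicit Types (t : R) (k : nat).

(** The classical function [exp (-1/t)] together with its multiples by powers of [1/t]. The family
    is closed under differentiation, [flat k] having derivative [flat (k+2) - k flat (k+1)], so
    smoothness of all members follows by one induction on the order. *)
Definition flat k t : R := if 0 < t then t^-1 ^+ k * expR (- t^-1) else 0.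

Lemma flat_ge0 k t : 0 <= flat k t.
Proof.
rewrite /flat; case: ifP => // t0.
by rewrite mulr_ge0 ?expR_ge0 // exprn_ge0 // invr_ge0 ltW.
Qed.

(** For [t > 0] this is [s^(k+1) <= (k+1)! e^s] at [s = 1/t], which comes from a single term of the
    exponential series. *)
Lemma flat_le k t : flat k t <= (k.+1)`!%:R * `|t|.
Proof.
rewrite /flat; case: ifP => [t0|_]; last by rewrite mulr_ge0.
have s0 : 0 <= t^-1 by rewrite invr_ge0 ltW.
have H : t^-1 ^+ k.+1 <= (k.+1)`!%:R * expR t^-1.
  have := expR_ge1Dxn k s0.
  rewrite -ler_pdivrMl ?ltr0n ?fact_gt0 // => H; apply: le_trans H.
  by rewrite [_^-1 * _]mulrC lerDr.
rewrite gtr0_norm // expRN ler_pdivrMr ?expR_gt0 //.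
rewrite -(ler_pM2r (_ : 0 < t^-1)) ?invr_gt0 // -exprSr (le_trans H) //.
rewrite le_eqVlt; apply/orP; left; apply/eqP; field.
by rewrite gt_eqF.
Qed.

Lemma is_derive_is_diff (W : normedModType R) (f : R -> W) (x : R) (df : W) :
  is_derive x 1 f df -> is_diff x f (fun v => v *: df).
Proof.
move=> [fd fE]; have fd' : differentiable f x by apply/derivable1_diffP.
by apply: DiffDef => //; rewrite deriv1E // derive1E fE.
Qed.

Lemma is_diff_flat_pos k t : 0 < t ->
  is_diff t (flat k) (fun v => v *: (flat k.+2 t - k%:R * flat k.+1 t)).
Proof.
move=> t0; pose f (s : R) : R := s^-1 ^+ k * expR (- s^-1).
suff fd : is_diff t f (fun v => v *: (flat k.+2 t - k%:R * flat k.+1 t)).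
  apply: near_eq_is_diff fd; near=> s.
  rewrite /flat ifT //; near: s; exact: lt_nbhsr.
have tn0 : t != 0 by rewrite gt_eqF.
apply: is_derive_is_diff.
have h1 : is_derive t 1 (fun s : R => s^-1) (- t ^- 2).
  by have := is_deriveV tn0 (is_derive_id t (1 : R)); rewrite scaler1.
have h2 : is_derive t 1 (fun s : R => expR (- s^-1)) (expR (- t^-1) * t ^- 2).
  have h := is_deriveN h1.
  have := @is_derive1_comp R expR (fun s => - s^-1) t _ _ (is_derive_expR (- t^-1)) h.
  by rewrite opprK /GRing.scale /= mulrC.
have h3 := is_deriveX k h1.
have h4 := is_deriveM h3 h2.
have fE : (GRing.inv : R -> R) ^+ k * (fun s : R => expR (- s^-1)) = f.
  by apply/funext => s; rewrite -[LHS]/(((GRing.inv : R -> R) ^+ k) s * expR (- s^-1)) exprfctE.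
have dE : (((GRing.inv : R -> R) ^+ k) t *: (expR (- t^-1) / t ^+ 2) +
    expR (- t^-1) *: ((k%:R * t^-1 ^+ k.-1) *: - t ^- 2)) =
    flat k.+2 t - k%:R * flat k.+1 t.
  rewrite exprfctE /flat t0 /GRing.scale /= -!exprVn.
  (* The power rule produces the exponent [k.-1], which is truncated at [k = 0]; there its
     coefficient [k] vanishes. *)
  case: k {fE h3 h4 f} => [|k]; rewrite /= ?exprS; ring.
by rewrite -fE -dE.
Unshelve. all: by end_near. Qed.
Lemma is_diff_flat0 k : is_diff (0 : R) (flat k) (fun=> 0).
Proof.
have zc : continuous (0 : R -> R) by exact: cst_continuous.
have flat0 : flat k 0 = 0 by rewrite /flat ltxx.
have E : flat k \o shift 0 = cst (flat k 0) + (0 : R -> R) +o_ (0 : R) id.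
  apply/eqaddoP => e e0; near=> t; rewrite !fctE /= flat0 !addr0 subr0.
  rewrite ger0_norm ?flat_ge0 //.
  (* One factor [t] is traded for an increase of [k]; as [flat k.+1] tends to [0] by [flat_le],
     [flat k t] is [o(t)]. *)
  have -> : flat k t = `|t| * flat k.+1 t.
    rewrite /flat; case: ifP => [t0|_]; last by rewrite mulr0.
    by rewrite gtr0_norm // exprS !mulrA mulfV ?mul1r // gt_eqF.
  rewrite mulrC ler_wpM2r // (le_trans (flat_le _ _)) // -ler_pdivlMl ?ltr0n ?fact_gt0 //.
  near: t; apply/nbhs_ballP; exists ((k.+2)`!%:R^-1 * e) => /=.
    by rewrite mulr_gt0 // invr_gt0 ltr0n fact_gt0.
  by move=> t; rewrite -ball_normE /= sub0r normrN => /ltW.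
have [d1 d2] : differentiable (flat k) (0 : R) /\ 'd (flat k) (0 : R) = 0 :> (R -> R).
  have dE : 'd (flat k) (0 : R) = 0 :> (R -> R) by apply: diff_unique.
  by split=> //; apply/diff_locallyP; rewrite dE.
by apply: DiffDef.
Unshelve. all: by end_near. Qed.

Lemma is_diff_flat k t :
  is_diff t (flat k) (fun v => v *: (flat k.+2 t - k%:R * flat k.+1 t)).
Proof.
have [t0|t0|<-] := ltgtP 0 t; first exact: is_diff_flat_pos.
  have E s : s < 0 -> flat k s = 0 by move=> s0; rewrite /flat ltNge ltW.
  rewrite (_ : (fun v => _) = (fun=> 0)).
    apply: near_eq_is_diff (is_diff_cst (0 : R) t).
    by near=> s; rewrite E //; near: s; exact: lt_nbhsl.
  by apply/funext => v; rewrite /flat ltNge ltW // mulr0 subr0 scaler0.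
rewrite (_ : (fun v => _) = (fun=> 0)); first exact: is_diff_flat0.
by apply/funext => v; rewrite /flat ltxx mulr0 subr0 scaler0.
Unshelve. all: by end_near. Qed.

Lemma smooth_flat k : smooth_on [set: R] (flat k).
Proof.
move=> m; elim: m k => [|m IH] k.
  move=> t _; have [+ _] := is_diff_flat k t; exact: differentiable_continuous.
apply: (cdiff_is_diff openT (df := fun t v => v *: (flat k.+2 t - k%:R * flat k.+1 t))).
  by move=> t _; exact: is_diff_flat.
move=> v; apply: (cdiff_scale openT (f := fun=> v)); first exact: cdiff_cst.
rewrite (_ : (fun x => _) = (fun t => flat k.+2 t + (- k%:R) *: flat k.+1 t)).
  apply: (cdiffD openT) => //.
  by apply: (cdiff_scale openT (f := fun=> - k%:R)) => //; exact: cdiff_cst.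
by apply/funext => t; rewrite scaleNr.
Qed.

End FlatFunctions.

Section Bump.
Variables (R : realType) (n : nat).
Implicit Types (x : 'rV[R]_n).

(** The denominator normalises the value at [x0] to [1]. The squared Euclidean distance is smooth
    and has a critical point at [x0], so multiplication by the bump changes neither the value nor
    the differential of a function at [x0]. *)
Definition bump (x0 : 'rV[R]_n) (r : R) x : R :=
  flat 0 (r ^+ 2 - pairing (x - x0) (x - x0)^T) / flat 0 (r ^+ 2).

Lemma flat_gt0 k (t : R) : 0 < t -> 0 < flat k t.
Proof. by move=> t0; rewrite /flat t0 mulr_gt0 ?expR_gt0 // exprn_gt0 // invr_gt0. Qed.

Lemma bump_center x0 r : 0 < r -> bump x0 r x0 = 1.
Proof.
move=> r0; rewrite /bump subrr trmx0 pairing0r subr0 divff //.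
by rewrite gt_eqF // flat_gt0 // exprn_gt0.
Qed.

Lemma bump_support x0 r x : 0 < r -> bump x0 r x != 0 -> `|x - x0| < r.
Proof.
move=> r0 bx.
have : 0 < r ^+ 2 - pairing (x - x0) (x - x0)^T.
  rewrite ltNge; apply: contra bx => h.
  by rewrite /bump /flat ltNge h mul0r.
rewrite subr_gt0 /pairing mxE => H.
move: (x - x0) H => y H.
(* The norm on matrices is the largest absolute value of an entry, whereas the bump is cut off at
   Euclidean distance [r]; the square of each entry is bounded by the sum of squares. *)
rewrite [ltLHS]/Num.Def.normr /= mx_normrE; apply: bigmax_lt => // -[i j] _ /=.
rewrite ord1 -(@ltr_pXn2r _ 2) ?nnegrE //; last exact: ltW.
rewrite real_normK ?num_real //.
have E k : y 0 k * y^T k 0 = y 0 k ^+ 2 by rewrite [y^T k 0]mxE expr2.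
apply: le_lt_trans H; rewrite (bigD1 j) //= E lerDl.
by apply: sumr_ge0 => k _; rewrite E sqr_ge0.
Qed.

Lemma smooth_sqdist x0 :
  smooth_on [set: 'rV[R]_n] (fun x => pairing (x - x0) (x - x0)^T).
Proof.
have s1 : smooth_on [set: 'rV[R]_n] (fun x => x - x0).
  apply: (smooth_onD openT); first exact: (smooth_on_linear openT idfun).
  exact: smooth_on_cst.
have s2 : smooth_on [set: 'rV[R]_n] (fun x => (x - x0)^T).
  by apply: (smooth_on_linear_comp openT trmx).
have s3 := smooth_on_mulmx openT s1 s2.
pose l (w : 'M[R]_1) : R := w 0 0.
have ll : linear (l : _ -> R^o) by move=> k w w'; rewrite /l !mxE.
pose L : {linear 'M[R]_1 -> R^o} := HB.pack (l : _ -> R^o) (GRing.isLinear.Build _ _ _ _ _ ll).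
by apply: (smooth_on_linear_comp openT L).
Qed.

Lemma smooth_bump x0 r : smooth_on [set: 'rV[R]_n] (bump x0 r).
Proof.
pose k := (flat 0 (r ^+ 2))^-1.
rewrite (_ : bump x0 r = fun x => k *: flat 0 (r ^+ 2 + (- 1) *: pairing (x - x0) (x - x0)^T)).
  apply: (smooth_on_scale openT); first exact: smooth_on_cst.
  apply: (smooth_on_comp openT openT _ _ (@smooth_flat R 0)) => //.
  apply: (smooth_onD openT); first exact: smooth_on_cst.
  by apply: (smooth_on_scale openT); [exact: smooth_on_cst|exact: smooth_sqdist].
by apply/funext => x; rewrite /bump /k scaleN1r /GRing.scale /= mulrC.
Qed.

Lemma is_diff_bump_center x0 r : is_diff x0 (bump x0 r) (fun=> 0).
Proof.
have s1 : is_diff x0 (fun x : 'rV[R]_n => x - x0) id.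
  have := is_diffB (is_diff_id x0) (is_diff_cst x0 x0).
  by rewrite subr0.
have s2 : is_diff x0 (fun x => pairing (x - x0) (x - x0)^T) (fun=> 0).
  have := is_diff_pairing s1 (is_diff_trmx s1).
  rewrite [X in is_diff _ _ X](_ : _ = fun=> 0) //.
  by apply/funext => v; rewrite /= subrr trmx0 pairing0l pairing0r addr0.
have s3 : is_diff x0 (fun x => r ^+ 2 - pairing (x - x0) (x - x0)^T) (fun=> 0).
  have := is_diffB (is_diff_cst (r ^+ 2) x0) s2.
  by rewrite subr0.
have s4 := is_diff_comp s3 (is_diff_flat 0 _).
have s5 := is_diffZ (flat 0 (r ^+ 2))^-1 s4.
move: s5; rewrite [X in is_diff _ X _](_ : _ = bump x0 r); last first.
  by apply/funext => x; rewrite /bump fctE /GRing.scale /= mulrC.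
rewrite [X in is_diff _ _ X](_ : _ = fun=> 0) //.
by apply/funext => v; rewrite fctE /= scale0r scaler0.
Qed.

End Bump.

Lemma is_diff_scale_op (R : realType) (V W : normedModType R) {fW : fin_dim W}
    (f df : V -> R) (g dg : V -> W) (x : V) :
  is_diff x f df -> is_diff x g dg ->
  is_diff x (fun y => f y *: g y) (fun v => f x *: dg v + df v *: g x).
Proof.
move=> fd gd; exact: (@is_diff_bilin _ _ _ _ _ _ _ (@scale_op R W) _ _ _ _ _ fd gd).
Qed.

Lemma fibre_map0 (R : pzRingType) n (v : 'rV[R]_n) (xi : 'cV[R]_n) (J K L N : 'M[R]_n) :
  v = 0 -> xi = 0 -> (0, 0) = (v *m J *m K, L *m (N *m xi)).
Proof. by move=> -> ->; rewrite !mul0mx !mulmx0. Qed.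

Section Extension.
Variables (R : realType) (n : nat) (M : manifold R n).

(* The extension is a bump function times [s], supported in a compact subset of
   the chart domain; that subset is closed in [M] because [M] is Hausdorff. *)
Lemma section_extension (p : M) (s : 'rV[R]_n -> fibre R n) :
  smooth_on [set: 'rV[R]_n] s ->
  exists A, [/\ smooth_section A, A p = s (pos p)
    & is_diff (pos p) (loc (chart_at p) A) ('d s (pos p))].
Proof.
move=> ss; have [Ap pp] := chart_atP p; set c0 := chart_at p in Ap pp *.
have oT := open_target Ap.
have Tp : target c0 (pos p) by exact: target_pos.
have /nbhs_ballP[r2 /= r20 rT] : nbhs (pos p) (target c0) by exact: open_nbhs_nbhs.
(* Half the radius, so that the closed ball [K] still lies in the open ball contained in the chart
   image. *)
pose r := r2 / 2; have r0 : 0 < r by rewrite divr_gt0.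
pose K := closed_ball (pos p) r.
have KT : K `<=` target c0.
  apply: subset_trans rT; apply: closed_ball_subset => //.
  by rewrite /r ltr_pdivrMr // ltr_pMr // ltr1n.
have cK : compact K.
  apply: bounded_closed_compact; last exact: closed_ball_closed.
  exists (`|pos p| + r); split; first exact: num_real.
  move=> m /ltW rm x; rewrite /K closed_ballE // /closed_ball_ /= => xr.
  apply: le_trans rm; rewrite -[x in leLHS](subrK (pos p)) addrC.
  by rewrite (le_trans (ler_normD _ _)) // lerD2l distrC.
have cK' : closed (from c0 @` K).
  apply: compact_closed; first exact: manifold_hausdorff.
  apply: continuous_compact => //; apply: continuous_in_subspaceT => x.
  rewrite inE => /KT Tx; have [_ _ _ _] := atlas_chart Ap; exact.
pose rho := bump (pos p) r.
have rhoK x : rho x != 0 -> K x.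
  move=> /(bump_support r0) xr; apply: subset_closed_ball.
  by rewrite -ball_normE /= distrC.
have [S SE] : exists S : 'rV[R]_n -> fibre R n, S = fun x => rho x *: s x by exists (fun x => rho x *: s x).
pose A q : fibre R n := if pselect (source c0 q) then
  ((S (to c0 q)).1 *m dm id c0 (chart_at q) q, dm id (chart_at q) c0 q *m (S (to c0 q)).2)
  else 0.
have locA q : source c0 q -> loc c0 A (to c0 q) = S (to c0 q).
  move=> c0q; have [Aq qq] := chart_atP q.
  rewrite (locE _ Ap c0q) /A; case: pselect => // _ /=.
  have := dm_transK Ap Aq c0q qq; move: (S (to c0 q)) => [v xi] /=.
  move: (dm id c0 (chart_at q) q) (dm id (chart_at q) c0 q) => J L JL.
  by rewrite -(mulmxA v) (mulmxA J) JL mulmx1 mul1mx.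
have locA' x : target c0 x -> loc c0 A x = S x by move=> [q cq <-]; exact: locA.
have sS : smooth_on [set: 'rV[R]_n] S.
  by rewrite SE; apply: (smooth_on_scale openT) => //; exact: smooth_bump.
have dS : is_diff (pos p) (loc c0 A) ('d s (pos p)).
  have sd := smooth_on_is_diff ss (I : setT (pos p)).
  have Sd : is_diff (pos p) S ('d s (pos p)).
    have h : is_diff (pos p) (fun y => rho y *: s y)
        (fun v => rho (pos p) *: 'd s (pos p) v + 0 *: s (pos p)).
      exact: (is_diff_scale_op (is_diff_bump_center (pos p) r) sd).
    have E : (fun v => rho (pos p) *: 'd s (pos p) v + 0 *: s (pos p)) = 'd s (pos p).
      by apply/funext => v; rewrite /rho bump_center // scale1r scale0r addr0.
    by rewrite E in h; rewrite SE.
  apply: near_eq_is_diff Sd.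
  by apply: filterS (open_near oT Tp) => x /locA' ->.
exists A; split=> //; last by rewrite -[LHS]loc_pos locA' // SE /rho bump_center // scale1r.
apply: smooth_section_local => q.
  have [c0q|c0q] := pselect (source c0 q).
  exists c0, (target c0); split=> //; split=> //; first by exists q.
  apply: (smooth_on_ext oT (f := S)); first by move=> x; rewrite inE => /locA'.
  exact: smooth_on_subset sS.
(* Around a point outside the domain of [c0], the complement of the image of [K] is an open
   neighbourhood on which [A] vanishes: a point there is either outside the domain of [c0], or its
   bump factor is [0]. *)
have [Aq qq] := chart_atP q; set c := chart_at q in Aq qq *.
  have [_ oc _ _ cc] := atlas_chart Aq.
  exists c, (target c `&` from c @^-1` (~` (from c0 @` K))).
  have oU : open (target c `&` from c @^-1` (~` (from c0 @` K))).
    by apply: open_setI_preimage => //; exact: closed_openC.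
  split=> //; split; last first.
  + apply: (smooth_on_ext oU (f := cst 0)); last exact: smooth_on_cst.
    move=> x; rewrite inE => -[[q' cq' <-]] /=; rewrite (atlasK Aq cq') => nK.
    rewrite (locE _ Aq cq') /A; case: pselect => /= c0q'; last by rewrite mul0mx mulmx0.
    have rho0 : rho (to c0 q') = 0.
      apply/eqP; apply: contra_notT nK => /rhoK Kq'.
      by exists (to c0 q') => //; exact: atlasK.
    have S0 : S (to c0 q') = 0 by rewrite SE rho0 scale0r.
    have S1 : (S (to c0 q')).1 = 0 :> 'rV[R]_n by rewrite S0.
    have S2 : (S (to c0 q')).2 = 0 :> 'cV[R]_n by rewrite S0.
    exact: fibre_map0.
  + by move=> x [].
  + split; first by exists q.
    rewrite /= (atlasK Aq qq) => -[x /KT[q' c0q' <-]]; rewrite (atlasK Ap c0q') => E.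
    by apply: c0q; rewrite -E.
Qed.

(** Differentials of rank one suffice to test the bracket. The section extends an affine map of the
    coordinates whose constant term is adjusted to give the value [a] at [p]. *)
Lemma section_jet (p : M) (a b : fibre R n) (lam : 'cV[R]_n) :
  exists A, [/\ smooth_section A, A p = a
    & is_diff (pos p) (loc (chart_at p) A) (fun v => pairing v lam *: b)].
Proof.
pose l (w : 'rV[R]_n) : R := pairing w lam.
have ll : linear (l : _ -> R^o) by move=> k w w'; rewrite /l pairingDl pairingZl.
pose L : {linear 'rV[R]_n -> R^o} := HB.pack (l : _ -> R^o) (GRing.isLinear.Build _ _ _ _ _ ll).
pose s x : fibre R n := l x *: b + (a - l (pos p) *: b).
have ss : smooth_on [set: 'rV[R]_n] s.
  apply: (smooth_onD openT); last exact: smooth_on_cst.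
  apply: (smooth_on_scale openT); last exact: smooth_on_cst.
  exact: (smooth_on_linear openT L).
have sd : is_diff (pos p) s (fun v => l v *: b).
  have h : is_diff (pos p) (fun x => l x *: b) (fun v => l (pos p) *: 0 + l v *: b).
    exact: (is_diff_scale_op (is_diff_linear L (pos p)) (is_diff_cst b (pos p))).
  have := is_diffD h (is_diff_cst (a - l (pos p) *: b) (pos p)).
  have -> : (fun v => l (pos p) *: 0 + l v *: b) + 0 = (fun v => l v *: b).
    by apply/funext => v; rewrite fctE scaler0 add0r addr0.
  by [].
have [A [sA Ap dA]] := section_extension p ss; exists A; split=> //.
  by rewrite Ap /s addrC subrK.
by have [_ <-] := sd.
Qed.

End Extension.

(** * Courant automorphisms over the identity *)

Section FibreAlgebra.
Variables (R : realType) (n : nat).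
Implicit Types (a b : fibre R n) (v w : 'rV[R]_n) (lam xi : 'cV[R]_n).

Lemma pairing_extl v w : (forall xi, pairing v xi = pairing w xi) -> v = w.
Proof.
move=> E; apply/rowP => j; have := E (delta_mx j 0).
by rewrite /pairing -!colE !mxE.
Qed.

Lemma inner_nondegenerate a : (forall b, inner a b = 0) -> a = 0.
Proof.
move=> a0; have h : (2^-1 : R) != 0 by rewrite invr_eq0 pnatr_eq0.
case: a a0 => v xi a0; congr pair.
  apply: pairing_extl => eta; have := a0 (0, eta).
  rewrite /inner /= !pairing0l add0r => /eqP.
  by rewrite mulf_eq0 (negbTE h) /= => /eqP.
apply: pairing_ext => w; have := a0 (w, 0).
rewrite /inner /= !pairing0r addr0 => /eqP.
by rewrite mulf_eq0 (negbTE h) /= => /eqP.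
Qed.

Lemma pairing_trmx_eq0 lam : pairing lam^T lam = 0 -> lam = 0.
Proof.
rewrite /pairing mxE => /eqP; rewrite psumr_eq0 => [/allP h|i _]; last first.
  by rewrite mxE -expr2 sqr_ge0.
apply/colP => i; have := h i (mem_index_enum _).
by rewrite !mxE -expr2 sqrf_eq0 => /eqP.
Qed.

Lemma subr_exchange (V : zmodType) (x y z t : V) : x - y = z - t -> x - z = y - t.
Proof.
by move=> /eqP; rewrite subr_eq => /eqP ->; rewrite addrAC [z - t]addrC addrK addrC.
Qed.

(* For the first claim, evaluate the hypothesis at [b = (a.1, - a.2)], which is
   orthogonal to [a]. *)
Lemma orthogonal_anchor (G : fibre R n -> fibre R n) :
  linear G -> (forall a b, inner (G a) (G b) = inner a b) ->
  (forall a b lam, G (pairing a.1 lam *: b - inner a b *: (0, lam)) =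
     pairing (G a).1 lam *: G b - inner (G a) (G b) *: (0, lam)) ->
  (forall a, (G a).1 = a.1) /\ (forall lam, G (0, lam) = (0, lam)).
Proof.
move=> linG oG H.
pose L : {linear fibre R n -> fibre R n} := HB.pack G (GRing.isLinear.Build _ _ _ _ _ linG).
have GB a b : G (a - b) = G a - G b by exact: (linearB L).
have G0 : G 0 = 0 by exact: (linear0 L).
have GZ k a : G (k *: a) = k *: G a by rewrite -[k *: a]addr0 linG G0 addr0.
have inj a : G a = 0 -> a = 0.
  move=> Ga; apply: inner_nondegenerate => b; rewrite -oG Ga.
  by rewrite /inner pairing0r pairing0l addr0 mulr0.
have H' a b lam : (pairing a.1 lam - pairing (G a).1 lam) *: G b =
    inner a b *: (G (0, lam) - (0, lam)).
  rewrite scalerBl scalerBr; apply: subr_exchange.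
  by have := H a b lam; rewrite oG GB !GZ.
have anchor a : (G a).1 = a.1.
  have [->|a0] := eqVneq a 0; first by rewrite G0.
  apply: pairing_extl => lam.
  have := H' a (a.1, - a.2) lam.
  have -> : inner a (a.1, - a.2) = 0.
    by rewrite /inner /= pairingNr addrN mulr0.
  rewrite scale0r => /eqP; rewrite scaler_eq0 subr_eq0 => /orP[/eqP //|/eqP /inj].
  move=> /(congr1 (fun z => (z.1, - z.2))) /=; rewrite opprK oppr0 => a0'.
  by case/eqP: a0; move: a0'; case: (a).
split=> // lam; have [->|lam0] := eqVneq lam 0; first by rewrite -[(0, 0)]/(0 : fibre R n) G0.
(* For the second claim, [(0, lam)] has vector part [0] before and after [G], so the left side of
   [H'] vanishes, while its inner product with [(lam^T, 0)] is half the sum of the squares of the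
   entries of [lam] and hence nonzero. *)
have := H' (0, lam) (lam^T, 0) lam.
rewrite anchor subrr scale0r => /esym /eqP; rewrite scaler_eq0 => /orP[|]; last first.
  by rewrite subr_eq0 => /eqP.
rewrite /inner /= pairing0l addr0 mulf_eq0 invr_eq0 pnatr_eq0 /= => /eqP.
by move=> /pairing_trmx_eq0 /eqP; rewrite (negbTE lam0).
Qed.

(** The covector part of [G] on tangent vectors is a linear map from vectors to covectors.
    Orthogonality on pairs [(v, 0)] and [(w, 0)] states precisely that the matrix of this map is
    skew. *)
Lemma orthogonal_B_field (G : fibre R n -> fibre R n) :
  linear G -> (forall a b, inner (G a) (G b) = inner a b) ->
  (forall a, (G a).1 = a.1) -> (forall lam, G (0, lam) = (0, lam)) ->
  exists2 B : 'M[R]_n, B^T = - B & forall a, G a = (a.1, a.2 + contract a.1 B).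
Proof.
move=> linG oG G1 G0.
pose L : {linear fibre R n -> fibre R n} := HB.pack G (GRing.isLinear.Build _ _ _ _ _ linG).
pose beta v : 'rV[R]_n := ((G (v, 0)).2)^T.
have lbeta : linear beta.
  move=> k v w; rewrite /beta.
  have -> : ((k *: v + w, 0) : fibre R n) = k *: (v, 0) + (w, 0).
    by congr pair; rewrite /= ?scaler0 ?addr0.
  by rewrite linG /= linearP.
pose Lb : {linear 'rV[R]_n -> 'rV[R]_n} := HB.pack beta (GRing.isLinear.Build _ _ _ _ _ lbeta).
pose B := lin1_mx Lb.
have BE v : contract v B = (G (v, 0)).2.
  by rewrite /contract mul_rV_lin1 /= /beta trmxK.
exists B.
  apply: mulmx_ext => v; apply: trmx_inj; apply: pairing_ext => w.
  rewrite -/(contract v B^T) -/(contract v (- B)).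
  have -> : contract v (- B) = - contract v B.
    by rewrite /contract mulmxN linearN.
  rewrite pairingNr !pairing_contract.
  have -> : (v *m B^T *m w^T) 0 0 = (w *m B *m v^T) 0 0.
    have -> : v *m B^T *m w^T = (w *m B *m v^T)^T by rewrite !trmx_mul !trmxK mulmxA.
    by rewrite mxE.
  rewrite -!pairing_contract !BE.
  have := oG (v, 0) (w, 0); rewrite /inner !G1 /= !pairing0r addr0 mulr0.
  move=> /eqP; rewrite mulf_eq0 invr_eq0 pnatr_eq0 /= addr_eq0 => /eqP ->.
  by rewrite opprK.
move=> [v xi]; rewrite BE /=.
have -> : (v, xi) = 1 *: (v, 0) + (0, xi) :> fibre R n.
  by rewrite scale1r; congr pair; rewrite /= ?addr0 ?add0r.
rewrite linG G0 scale1r [LHS]surjective_pairing; apply: congr2.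
  by rewrite -[LHS]/((G (v, 0)).1 + 0) G1 addr0.
by rewrite -[LHS]/((G (v, 0)).2 + xi) addrC.
Qed.

End FibreAlgebra.

Section IdentityCovering.
Variables (R : realType) (n : nat) (M : manifold R n).

(** Every derivative of [A] in the bracket is multiplied by the value of [A'] at [p], so only the
    differential of [A'] contributes. *)
Lemma courant_vanishing (A A' : M -> fibre R n) (p : M) (b : fibre R n) (lam : 'cV[R]_n) :
  smooth_section A -> A' p = 0 ->
  is_diff (pos p) (loc (chart_at p) A') (fun v => pairing v lam *: b) ->
  courant A A' p = pairing (A p).1 lam *: b - inner (A p) b *: (0, lam).
Proof.
move=> sA A'0 dA'; rewrite courant_loc.
have := local_courantE (smooth_section_is_diff p sA) dA'.
rewrite !loc_pos A'0; move: (local_courant _ _ _) => C.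
rewrite -[(0 : fibre R n).1]/(0 : 'rV[R]_n) linear0 => -[C1 C2].
apply: fibre_ext; first by rewrite C1 /= scaler0 !subr0.
move=> w; rewrite C2 /=.
rewrite !(pairingDr, pairingNr, pairingZr, pairingZl).
rewrite /inner /= !(pairing0r, pairing0l, pairingZr, pairingZl).
ring.
Qed.

Definition bundle_map_in (c : chart M 'rV[R]_n) (G : total_space M -> total_space M)
    (x : 'rV[R]_n) (a : fibre R n) : fibre R n :=
  (to (bundle_chart c) (G (from (bundle_chart c) (x, a)))).2.

(** The product rule has a second term, containing the derivative of [G], which is multiplied by
    [alpha x = 0]. Expanding [alpha] in coordinates reduces the claim to the smooth functions
    [G ^~ (e i)]. *)
Lemma is_diff_bundle_map (V : normedModType R) (U : set V) (G : V -> fibre R n -> fibre R n)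
    (alpha dalpha : V -> fibre R n) x :
  open U -> U x -> (forall a, smooth_on U (G ^~ a)) -> (forall y, U y -> linear (G y)) ->
  alpha x = 0 -> is_diff x alpha dalpha ->
  is_diff x (fun y => G y (alpha y)) (fun v => G x (dalpha v)).
Proof.
move=> oU Ux sG lG ax ad.
have : fin_dim (fibre R n : normedModType R) by exact: _.
move=> [m [e [l [l1 l2 l3]]]].
have Gsum y a : U y -> G y a = \sum_i l i a *: G y (e i).
  move=> Uy; pose L : {linear fibre R n -> fibre R n} :=
    HB.pack (G y) (GRing.isLinear.Build _ _ _ _ _ (lG y Uy)).
  rewrite -[LHS]/(L a) {1}(l3 a) linear_sum; apply: eq_bigr => i _.
  by rewrite linearZ.
have ld i : is_diff x (l i \o alpha) (l i \o dalpha).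
  pose L : {linear fibre R n -> R^o} := HB.pack (l i : _ -> R^o) (GRing.isLinear.Build _ _ _ _ _ (l1 i)).
  exact: (is_diff_comp ad (is_diff_linear L (alpha x))).
have l0 i : l i 0 = 0.
  pose L : {linear fibre R n -> R^o} := HB.pack (l i : _ -> R^o) (GRing.isLinear.Build _ _ _ _ _ (l1 i)).
  exact: (linear0 L).
have td i : is_diff x (fun y => l i (alpha y) *: G y (e i))
    (fun v => l i (dalpha v) *: G x (e i)).
  have h : is_diff x (fun y => l i (alpha y) *: G y (e i))
      (fun v => l i (alpha x) *: 'd (G ^~ (e i)) x v + l i (dalpha v) *: G x (e i)).
    exact: (is_diff_scale_op (ld i) (smooth_on_is_diff (sG (e i)) Ux)).
  move: h; rewrite ax l0.
  have -> : (fun v => 0 *: 'd (G ^~ (e i)) x v + l i (dalpha v) *: G x (e i)) =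
    (fun v => l i (dalpha v) *: G x (e i)).
    by apply/funext => v; rewrite scale0r add0r.
  by [].
have := is_diff_sum td.
have -> : (fun v => \sum_i l i (dalpha v) *: G x (e i)) = (fun v => G x (dalpha v)).
  by apply/funext => v; rewrite -Gsum.
apply: near_eq_is_diff; apply: filterS (open_near oU Ux) => y Uy.
by rewrite Gsum.
Qed.

End IdentityCovering.

Lemma fibre_map_linear (R : realType) n (J K : 'M[R]_n) :
  linear (fun a : fibre R n => (a.1 *m J, K *m a.2) : fibre R n).
Proof.
move=> k a b; congr pair; rewrite /=.
  by rewrite mulmxDl -scalemxAl.
by rewrite mulmxDr -scalemxAr.
Qed.

Section Reduction.
Variables (R : realType) (n : nat) (M : manifold R n).
Local Notation smoothE := (smooth_map (bundle_atlas M) (bundle_atlas M)).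

Variable G : total_space M -> total_space M.
Hypothesis sG : smoothE G.
Hypothesis G1 : forall e, (G e).1 = e.1.
Hypothesis linG : forall p, linear (fun a : fibre R n => (G (p, a)).2).

Lemma bundle_map_inE c q (a : fibre R n) : atlas M c -> source c q ->
  let z := (G (q, (a.1 *m dm id c (chart_at q) q, dm id (chart_at q) c q *m a.2))).2 in
  bundle_map_in c G (to c q) a = (z.1 *m dm id (chart_at q) c q, dm id c (chart_at q) q *m z.2).
Proof.
move=> Ac cq z; rewrite /bundle_map_in (bundle_chart_from a Ac cq).
by rewrite [G _]surjective_pairing G1 bundle_chart_to.
Qed.

Lemma bundle_map_in_loc c A x : atlas M c -> target c x ->
  bundle_map_in c G x (loc c A x) = loc c (act id G A) x.
Proof.
move=> Ac [q cq <-]; have [Aq qq] := chart_atP q.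
rewrite (bundle_map_inE _ Ac cq) !(locE _ Ac cq) /=.
have := dm_transK Aq Ac qq cq.
move: (dm id (chart_at q) c q) (dm id c (chart_at q) q) => J K JK.
rewrite -(mulmxA _ J K) (mulmxA J K) JK mulmx1 mul1mx.
by rewrite /act; case: (A q).
Qed.

Lemma bundle_map_in_pos p a : bundle_map_in (chart_at p) G (pos p) a = (G (p, a)).2.
Proof.
have [Ap pp] := chart_atP p.
rewrite /pos (bundle_map_inE _ Ap pp) (dm_id Ap pp) !mulmx1 !mul1mx.
by rewrite -!surjective_pairing.
Qed.

Lemma bundle_map_in_linear c x : atlas M c -> target c x -> linear (bundle_map_in c G x).
Proof.
move=> Ac [q cq <-] k a b; rewrite !(bundle_map_inE _ Ac cq).
move: (dm id (chart_at q) c q) (dm id c (chart_at q) q) => J K.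
by rewrite (fibre_map_linear K J) linG; exact: fibre_map_linear.
Qed.

Lemma bundle_map_in_smooth c a : atlas M c ->
  smooth_on (target c) (bundle_map_in c G ^~ a).
Proof.
move=> Ac; have Bc : bundle_atlas M (bundle_chart c) by exists c.
have [_ s] := sG Bc Bc; rewrite -/(chart_dom _ _ _) in s.
have oT := open_target Ac; have oU := open_fst_preimage oT.
have s1 : smooth_on [set y : 'rV[R]_n * fibre R n | target c y.1]
    (to (bundle_chart c) \o G \o from (bundle_chart c)).
  apply: smooth_on_subset s => y [q cq yq].
  by rewrite (@bundle_chart_dom _ _ _ id) //=; exists q.
apply: (smooth_on_linear_comp oT snd).
apply: (smooth_on_comp oT oU (f := fun x => (x, a)) _ _ s1) => //.
apply: smooth_on_pair => //; first exact: (smooth_on_linear oT idfun).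
exact: smooth_on_cst.
Qed.

Hypothesis oG : orthogonal_automorphism G.
Hypothesis cG : forall A A', smooth_section A -> smooth_section A' ->
  act id G (courant A A') = courant (act id G A) (act id G A').

Lemma smooth_section_act_id A : smooth_section A -> smooth_section (act id G A).
Proof. by move=> sA; apply: (@smooth_section_act _ _ _ id id) => //; exact: smooth_id. Qed.

Lemma act_id_anchor p (a b : fibre R n) (lam : 'cV[R]_n) :
  let Gp a := (G (p, a)).2 in
  Gp (pairing a.1 lam *: b - inner a b *: (0, lam)) =
     pairing (Gp a).1 lam *: Gp b - inner (Gp a) (Gp b) *: (0, lam).
Proof.
move=> Gp; have [Ap pp] := chart_atP p.
have [A [sA Aa _]] := section_jet p a 0 0.
have [A' [sA' A'0 dA']] := section_jet p 0 b lam.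
have := cG sA sA'; move=> /(congr1 (fun C => C p)).
rewrite [LHS]/act (courant_vanishing sA A'0 dA') Aa => E.
rewrite -[LHS]/((G (p, pairing a.1 lam *: b - inner a b *: (0, lam))).2) E.
have GA : act id G A p = Gp a by rewrite /act Aa.
have GA' : act id G A' p = 0.
  rewrite /act A'0; have := linG p 0 0 0; rewrite scaler0 scale0r !add0r => ->.
  by have := linG p (-1) 0 0; rewrite scaler0 addr0 scaleN1r addNr.
(* The image section again vanishes at [p] with a differential of rank one, [b] being replaced by
   [Gp b]. Hence [courant_vanishing] evaluates both sides of the bracket identity. *)
have d1 : is_diff (pos p) (loc (chart_at p) (act id G A')) (fun v => pairing v lam *: Gp b).
  have oT := open_target Ap; have Tp := target_pos p.
  have h := is_diff_bundle_map oT Tp (fun a => bundle_map_in_smooth a Ap)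
     (fun y => @bundle_map_in_linear _ y Ap) (etrans (loc_pos A' p) A'0) dA'.
  have -> : (fun v => pairing v lam *: Gp b) =
    (fun v => bundle_map_in (chart_at p) G (pos p) (pairing v lam *: b)).
    apply/funext => v; rewrite bundle_map_in_pos.
    have := linG p (pairing v lam) b 0; rewrite addr0.
    have -> : (G (p, 0)).2 = 0 by move: GA'; rewrite /act A'0.
    by rewrite addr0.
  apply: near_eq_is_diff h; apply: filterS (open_near oT Tp) => y Ty.
  exact: bundle_map_in_loc.
by rewrite (courant_vanishing (smooth_section_act_id sA) GA' d1) GA.
Qed.

(** The fibrewise lemmas produce a matrix [B p] separately for each [p], so the smoothness of [B]
    still has to be recovered from that of [G]. *)
Lemma covering_identity : exists2 B, closed_two_form M B & G = B_field M B.
Proof.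
have H p : exists2 B : 'M[R]_n, B^T = - B & forall a, (G (p, a)).2 = (a.1, a.2 + contract a.1 B).
  have [anchor Glam] := orthogonal_anchor (linG p) (oG p) (act_id_anchor p).
  exact: (orthogonal_B_field (linG p) (oG p) anchor Glam).
pose B p := s2val (cid2 (H p)).
have sB p : (B p)^T = - B p by exact: (s2valP (cid2 (H p))).
have GB : G = B_field M B.
  apply/funext => -[p a]; rewrite [LHS]surjective_pairing G1.
  by rewrite (s2valP' (cid2 (H p))).
have tB : two_form B.
  split=> // c Ac; have oT := open_target Ac.
  (* Row [i] of the form in the chart [c] is the transposed covector part of the image of
     [(delta_mx 0 i, 0)] under [G] read in [c]; the sum puts the rows back together. *)
  pose F x := \sum_(i < n) (delta_mx i 0 : 'cV[R]_n) *m
     ((bundle_map_in c G x (delta_mx 0 i, 0)).2)^T.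
  apply: (smooth_on_ext oT (f := F)); last first.
    apply: (smooth_on_sum oT) => i; apply: (smooth_on_mulmx oT); first exact: smooth_on_cst.
    apply: (smooth_on_linear_comp oT trmx); apply: (smooth_on_linear_comp oT snd).
    exact: bundle_map_in_smooth.
  move=> x; rewrite inE => -[q cq <-]; have [Aq qq] := chart_atP q.
  have E v : ((bundle_map_in c G (to c q) (v, 0)).2)^T = v *m form_in c B (to c q).
    rewrite (bundle_map_inE _ Ac cq) GB /=.
    have := contract_form_in B (v *m dm id c (chart_at q) q) Ac cq.
    have := dm_transK Ac Aq cq qq.
    move: (form_in c B (to c q)) (B q) => f b.
    move: (dm id c (chart_at q) q) (dm id (chart_at q) c q) => K J KJ.
    rewrite -mulmxA KJ mulmx1 => Ef.
    by rewrite mulmx0 add0r -Ef trmxK.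
  rewrite /F; under eq_bigr do rewrite E mulmxA.
  rewrite -mulmx_suml.
  have -> : \sum_(i < n) (delta_mx i 0 : 'cV[R]_n) *m delta_mx 0 i = 1%:M.
    rewrite [RHS]matrix_sum_delta; apply: eq_bigr => i _.
    rewrite (bigD1 i) //= big1 ?addr0; last first.
      by move=> j ij; rewrite mxE eq_sym (negbTE ij) scale0r.
    by rewrite mxE eqxx scale1r mul_delta_mx.
  by rewrite mul1mx.
exists B => //; split=> // p u v w.
have [A [sA Au _]] := section_jet p (u, 0) 0 0.
have [A' [sA' Av _]] := section_jet p (v, 0) 0 0.
have [_ /(_ w)] := courant_B_field p tB sA sA'.
have := cG sA sA'; rewrite GB => /(congr1 (fun C => C p)) <-.
rewrite Au Av /act /B_field /=; move: (pairing w _) => k /eqP.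
by rewrite eq_sym -subr_eq0 addrAC subrr add0r => /eqP.
Qed.

End Reduction.

(** * The group of orthogonal Courant automorphisms *)

Section AutomorphismGroup.
Variables (R : realType) (n : nat) (M : manifold R n).
Implicit Types (f g : M -> M) (F : total_space M -> total_space M) (B : M -> 'M[R]_n).

Local Notation diffeoM := (diffeomorphism (atlas M) (atlas M)).
Local Notation aut := (elements (courant_automorphisms M)).

Lemma smooth_atlas_id (T : Type) (V : normedModType R) (A : set (chart T V)) :
  smooth_atlas A -> diffeomorphism A A id.
Proof. by move=> [_ _ sid]; split=> //; exists id. Qed.

Lemma diffeomorphism_inv (T : Type) (V : normedModType R) (A : set (chart T V))
    (f g : T -> T) : diffeomorphism A A f -> cancel f g -> cancel g f ->
  diffeomorphism A A g /\ smooth_map A A g.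
Proof.
move=> [sf [h [sh fK hK]]] gK Kg.
have -> : g = h by apply/funext => x; rewrite -[g x]fK Kg.
by split=> //; split=> //; exists f.
Qed.

(** [preserves_courant] quantifies over all inverses of [f]; since the inverse is unique, one of
    them is enough. *)
Lemma preserves_courant_inv f g F : cancel f g -> cancel g f ->
  preserves_courant f F <->
  (forall A A', smooth_section A -> smooth_section A' ->
     act g F (courant A A') = courant (act g F A) (act g F A')).
Proof.
move=> fK gK; split=> [H|H g' fK' gK']; first exact: H.
have -> : g' = g by apply/funext => x; rewrite -[LHS]fK gK'.
exact: H.
Qed.

Lemma act_comp f2 F1 F2 g1 g2 A : (forall e, (F2 e).1 = f2 e.1) -> cancel g2 f2 ->
  act (g2 \o g1) (F1 \o F2) A = act g1 F1 (act g2 F2 A).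
Proof.
move=> F2f gK; apply/funext => p; rewrite /act /=.
by rewrite [F2 _]surjective_pairing F2f /= gK.
Qed.

Lemma courant_automorphism_comp f1 F1 f2 F2 :
  aut (f1, F1) -> aut (f2, F2) -> aut (f1 \o f2, F1 \o F2).
Proof.
move=> [/= [df1 dF1 E1 l1] o1 c1] [/= [df2 dF2 E2 l2] o2 c2].
have [_ [g1 [sg1 f1K g1K]]] := df1; have [_ [g2 [sg2 f2K g2K]]] := df2.
have F2E p a : F2 (p, a) = (f2 p, (F2 (p, a)).2) by rewrite [LHS]surjective_pairing E2.
split=> /=; first split.
- exact: (diffeomorphism_comp (atlas_smooth M) (atlas_smooth M) (atlas_smooth M)).
- have sE := bundle_atlas_smooth M; exact: (diffeomorphism_comp sE sE sE).
- by move=> e; rewrite /= E1 E2.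
- by move=> p k a b; rewrite /= F2E l2 l1 -!F2E.
- by move=> p a b; rewrite /= (F2E p a) (F2E p b) o1 o2.
apply/(preserves_courant_inv (g := g2 \o g1)); [exact: can_comp|exact: can_comp|].
move=> A A' sA sA'; rewrite !(act_comp _ _ _ E2 g2K).
rewrite (c2 _ f2K g2K) // (c1 _ f1K g1K) //.
  exact: (smooth_section_act dF2.1 sg2 g2K E2).
exact: (smooth_section_act dF2.1 sg2 g2K E2).
Qed.

Lemma courant_automorphism_inv f F : aut (f, F) ->
  exists g G, [/\ aut (g, G), cancel f g, cancel g f, cancel F G & cancel G F].
Proof.
move=> [/= [df dF EF lF] oF cF].
have [sf [g [sg fK gK]]] := df; have [sF [G [sG FK GK]]] := dF.
have [dg _] := diffeomorphism_inv df fK gK; have [dG _] := diffeomorphism_inv dF FK GK.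
have EG e : (G e).1 = g e.1 by rewrite -[e in RHS]GK EF fK.
have GE p a : G (p, a) = (g p, (G (p, a)).2) by rewrite [LHS]surjective_pairing EG.
have FG p a : (F (g p, (G (p, a)).2)).2 = a by rewrite -GE GK.
exists g, G; split=> //; split=> /=; first split=> //.
(* Linearity of the inverse on the fibre at [p] is obtained by applying [G] to the linearity of [F]
   on the fibre at [g p]. *)
- move=> p k a b; have := lF (g p) k (G (p, a)).2 (G (p, b)).2; rewrite !FG => E.
  have /(congr1 G) : F (g p, k *: (G (p, a)).2 + (G (p, b)).2) = (p, k *: a + b).
    by rewrite [LHS]surjective_pairing E EF /= gK.
  by rewrite FK => <-.
- by move=> p a b; rewrite -(oF (g p)) !FG.
apply/(preserves_courant_inv G gK fK) => A A' sA sA'.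
have sGA := smooth_section_act sG sf fK EG sA.
have sGA' := smooth_section_act sG sf fK EG sA'.
have FGA D : act g F (act f G D) = D.
  by rewrite -(act_comp _ _ _ EG fK); apply/funext => p; rewrite /act /= gK GK.
have GFA D : act f G (act g F D) = D.
  by rewrite -(act_comp _ _ _ EF gK); apply/funext => p; rewrite /act /= fK FK.
by rewrite -[in LHS](FGA A) -[in LHS](FGA A') -(cF _ fK gK) // GFA.
Qed.

Lemma courant_automorphism_id : aut (id, id).
Proof.
split=> /=; first split=> //.
- exact: smooth_atlas_id (atlas_smooth M).
- exact: smooth_atlas_id (bundle_atlas_smooth M).
- by [].
by apply/(@preserves_courant_inv id id).
Qed.

Lemma courant_automorphisms_group : is_group (courant_automorphisms M).
Proof.
split.
- exact: courant_automorphism_id.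
- by move=> [f1 F1] [f2 F2]; exact: courant_automorphism_comp.
- by move=> [f1 F1] [f2 F2] [f3 F3] _ _ _.
- by move=> [f F] _.
- move=> [f F] /courant_automorphism_inv[g [G [aG fK gK FK GK]]].
  exists (g, G) => //; split; congr pair; apply/funext => x /=.
  + exact: gK.
  + exact: GK.
  + exact: fK.
  + exact: FK.
Qed.

Lemma Diff_group : is_group (Diff M).
Proof.
have sM := atlas_smooth M; split=> //.
- exact: smooth_atlas_id.
- by move=> f g df dg; exact: (diffeomorphism_comp sM sM sM dg df).
- move=> f df; have [_ [g [sg fK gK]]] := df.
  exists g; first by have [] := diffeomorphism_inv df fK gK.
  by split; apply/funext => x; [exact: gK | exact: fK].
Qed.

Lemma closed_two_form0 : closed_two_form M (fun=> 0).
Proof.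
have E c : form_in c (fun _ : M => (0 : 'M[R]_n)) = cst 0.
  by apply/funext => x; rewrite /form_in mulmx0 mul0mx.
split; first split.
- by move=> p; rewrite trmx0 oppr0.
- by move=> c Ac; rewrite E; exact: smooth_on_cst.
- move=> p u v w; rewrite /exterior_derivative E !derive_cst.
  by rewrite !mulmx0 !mul0mx !mxE !addr0.
Qed.

Lemma closed_two_formN B : closed_two_form M B -> closed_two_form M (fun p => (-1) *: B p).
Proof.
move=> [tB cB]; split; first exact: two_form_scale.
by move=> p u v w; rewrite exterior_derivativeZ // cB mulr0.
Qed.

Lemma closed_two_forms_group : is_group (closed_two_forms M).
Proof.
split.
- exact: closed_two_form0.
- move=> B B' [tB cB] [tB' cB']; split; first exact: two_formD.
  by move=> p u v w; rewrite exterior_derivativeD // cB cB' addr0.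
- by move=> B1 B2 B3 _ _ _; apply/funext => p; exact: addrA.
- by move=> B _; split; apply/funext => p; [exact: add0r|exact: addr0].
- move=> B cB; exists (fun p => (-1) *: B p); first exact: closed_two_formN.
  by split; apply/funext => p; rewrite /= scaleN1r; [exact: subrr|exact: addNr].
Qed.

Lemma diff_automorphism_aut f : diffeoM f -> aut (diff_automorphism M f).
Proof.
move=> df; have [sf [g [sg fK gK]]] := df.
split=> /=; first split=> //.
- split; first exact: (diff_action_smooth sf sg fK gK).
  have dg := (diffeomorphism_inv df fK gK).1.
  exists (diff_action M g); split; first exact: (diff_action_smooth sg sf gK fK).
    move=> e; rewrite -[LHS]/((diff_action M g \o diff_action M f) e).
    rewrite -(diff_action_comp dg df) (_ : g \o f = id) ?diff_action_id //.
    by apply/funext => p; exact: fK.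
  move=> e; rewrite -[LHS]/((diff_action M f \o diff_action M g) e).
  rewrite -(diff_action_comp df dg) (_ : f \o g = id) ?diff_action_id //.
  by apply/funext => p; exact: gK.
- move=> p k a b; exact: fibre_map_linear.
- move=> p a b; rewrite /inner /=.
  have [Ap pp] := chart_atP p; have [Afp pfp] := chart_atP (f p).
  have [u _] := dm_invmx sf sg fK gK Ap Afp pp pfp; rewrite -tangentE in u.
  have K (v : 'rV[R]_n) (xi : 'cV[R]_n) :
      pairing (v *m tangent f p) (invmx (tangent f p) *m xi) = pairing v xi.
    by rewrite -pairingM mulmxK.
  by rewrite !K.
apply/(preserves_courant_inv _ fK gK) => A A'.
exact: (diff_action_courant sf sg fK gK).
Qed.

Lemma B_field_automorphism_aut B : closed_two_form M B -> aut (B_field_automorphism M B).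
Proof.
move=> cB; have [tB _] := cB; have tB' := two_form_scale (-1) tB.
split=> /=; first split=> //.
- exact: smooth_atlas_id (atlas_smooth M).
- split; first exact: B_field_smooth.
  exists (B_field M (fun p => (-1) *: B p)); split; first exact: B_field_smooth.
    move=> e; rewrite -[LHS]/((B_field M _ \o B_field M _) e) B_fieldD.
    rewrite (_ : (fun p => _) = fun=> 0) ?B_field0 //.
    by apply/funext => p; rewrite scaleN1r addNr.
  move=> e; rewrite -[LHS]/((B_field M _ \o B_field M _) e) B_fieldD.
  rewrite (_ : (fun p => _) = fun=> 0) ?B_field0 //.
  by apply/funext => p; rewrite scaleN1r subrr.
- move=> p k [v xi] [w eta] /=; congr pair => /=.
  by rewrite contractDl contractZl scalerDr addrACA.
- move=> p a b; rewrite /inner /= !pairingDr.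
  by rewrite (contract_skew b.1 a.1 (tB.1 p)) addrACA addNr addr0.
apply/(@preserves_courant_inv id id) => // A A'.
exact: B_field_courant.
Qed.

Lemma B_field_inj B B' : B_field M B = B_field M B' -> B = B'.
Proof.
move=> E; apply/funext => p; apply: mulmx_ext => v.
have := congr1 (fun H => (H (p, (v, 0))).2.2) E.
by rewrite /= !add0r => /trmx_inj.
Qed.

Lemma courant_automorphism_decomposition f F : aut (f, F) ->
  exists2 B, closed_two_form M B & F = diff_action M f \o B_field M B.
Proof.
move=> aF; have [[df _ _ _] _ _] := aF; have [sf [g [sg fK gK]]] := df.
have dg := (diffeomorphism_inv df fK gK).1.
have [/= [_ [sG _] G1 lG] oG cG] := courant_automorphism_comp (diff_automorphism_aut dg) aF.
have gf : g \o f = id by apply/funext => p; exact: fK.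
rewrite gf in G1 cG.
have [B cB E] := covering_identity sG G1 lG oG (cG id (fun=> erefl) (fun=> erefl)).
exists B => //; rewrite -E compA -(diff_action_comp df dg).
rewrite (_ : f \o g = id) ?diff_action_id //.
by apply/funext => p; exact: gK.
Qed.

End AutomorphismGroup.

Theorem proposition3p24 (R : realType) (n : nat) (M : manifold R n) :
  (forall (f : M -> M) (F : total_space M -> total_space M),
      bundle_automorphism f F -> orthogonal_automorphism F -> preserves_courant f F ->
      exists2 B : M -> 'M[R]_n, closed_two_form M B &
        F = diff_action M f \o B_field M B) /\
  semidirect_product (courant_automorphisms M) (Diff M) (closed_two_forms M)
    (diff_automorphism M) (B_field_automorphism M).
Proof.
split=> [f F bF oF cF|]; first exact: courant_automorphism_decomposition.
split; first by split; [exact: courant_automorphisms_group|exact: Diff_group|exact: closed_two_forms_group].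
split.
- split.
  + exact: diff_automorphism_aut.
  + by move=> f g df dg; rewrite /diff_automorphism diff_action_comp.
  + by move=> f g _ _ /(congr1 fst).
- split.
  + exact: B_field_automorphism_aut.
  + by move=> B B' _ _; rewrite /B_field_automorphism /= B_fieldD.
  + by move=> B B' _ _ /(congr1 snd) /B_field_inj.
- move=> [f F] B aF cB.
  have [g [G [aG fK gK FK GK]]] := courant_automorphism_inv aF.
  have := courant_automorphism_comp (courant_automorphism_comp aF (B_field_automorphism_aut cB)) aG.
  move=> /courant_automorphism_decomposition[B' cB' E]; exists B' => //.
  have fg : f \o g = id by apply/funext => p; exact: gK.
  rewrite /= fg diff_action_id in E.
  congr pair; apply/funext => e /=.
  by have := congr1 (fun H => H (F e)) E; rewrite /= FK.
(* A [B]-field transformation covers the identity, so a diffeomorphism whose action is of this form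
   is [id]. *)
- move=> f B df _ E; have -> : f = id by move/(congr1 fst): E.
  by rewrite /diff_automorphism diff_action_id.
- move=> [f F] aF; have [B cB E] := courant_automorphism_decomposition aF.
  have [[df _ _ _] _ _] := aF.
  by exists f, B; split=> //; rewrite E.
Qed.
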